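(* Let $l\ge3$. For a semisimple Lie algebra $\mathfrak g$ with Iwasawa decomposition $\mathfrak g=\mathfrak k\oplus\mathfrak a\oplus\mathfrak n$ write $(\mathfrak a\oplus\mathfrak n)_{\mathfrak g}$ for its Iwasawa (solvable) component. Then $(\mathfrak a\oplus\mathfrak n)_{\mathfrak{so}(2,l-1)}$ is a split extension $$(\mathfrak a\oplus\mathfrak n)_{\mathfrak{so}(2,l-1)}=(\mathfrak a\oplus\mathfrak n)_{\mathfrak{su}(1,1)}\oplus_{\mathrm{ad}}(\mathfrak a\oplus\mathfrak n)_{\mathfrak{su}(1,l-2)} .$$
   Context: The notation $\mathfrak s=\mathfrak s_1\oplus_{\mathrm{ad}}\mathfrak s_2$ means that $\mathfrak s$ is the vector space direct sum of a subalgebra $\mathfrak s_1$ and an ideal $\mathfrak s_2$, with $\mathfrak s_1$ acting on $\mathfrak s_2$ by derivations through the adjoint action; the claimed equality is up to Lie algebra isomorphism of the components. Iwasawa components are unique up to isomorphism. Concretely $(\mathfrak a\oplus\mathfrak n)_{\mathfrak{so}(2,l-1)}$ has a basis $H_1,H_2,L,M,V_i,W_i$ ($5\le i\le l+1$) with nonzero brackets $[V_i,W_j]=\delta_{ij}M$, $[V_j,L]=2W_j$, $[H_1,V_i]=-V_i$, $[H_2,V_i]=V_i$, $[H_1,W_i]=W_i$, $[H_2,W_i]=W_i$, $[H_1,L]=2L$, $[H_2,M]=2M$. *)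

(* Defs.v *)
From HB Require Import structures.
From mathcomp Require Import all_boot all_order all_algebra.
From mathcomp Require Import reals.
From mathcomp Require Import complex.

Set Implicit Arguments.
Unset Strict Implicit.
Unset Printing Implicit Defensive.

Import Order.TTheory GRing.Theory Num.Theory.
Local Open Scope ring_scope.

HB.mixin Record isLieAlgebra (F : fieldType) L of Vector F L := {
  lie : L -> L -> L;
  lie_linearl : forall z : L, linear (lie^~ z);
  lie_linearr : forall x : L, linear (lie x);
  liexx : forall x : L, lie x x = 0;
  lie_jacobi : forall x y z : L,
    lie x (lie y z) + lie y (lie z x) + lie z (lie x y) = 0
}.

#[short(type="lieAlgType")]
HB.structure Definition LieAlgebra (F : fieldType) :=
  {L of isLieAlgebra F L & Vector F L}.

Section LieTheory.
Variables (F : fieldType) (L : lieAlgType F).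
Implicit Types (g h s U : {vspace L}).

Definition is_subalgebra g := forall x y, x \in g -> y \in g -> lie x y \in g.

Definition is_abelian g := forall x y, x \in g -> y \in g -> lie x y = 0.

Definition is_ideal_of g U :=
  (U <= g)%VS /\ forall x y, x \in g -> y \in U -> lie x y \in U.

(* The adjoint action of s1 on s2 is by derivations because of the Jacobi
   identity, so nothing more has to be required. *)
Definition is_split_extension s s1 s2 :=
  [/\ is_subalgebra s1, is_ideal_of s s2, s = (s1 + s2)%VS
    & directv (s1 + s2)].

(* Trace of ad x \o ad y on the subalgebra g (not on the ambient L), computed
   in a basis of g. *)
Definition killing g (x y : L) : F :=
  \sum_(i < \dim g) coord (vbasis g) i (lie x (lie y (vbasis g)`_i)).

End LieTheory.

(* A linear map between subspaces extends to the ambient spaces, so there is no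
   loss in taking the isomorphism as the restriction of a map f : L -> L'. *)
Definition lie_isomorphic (F : fieldType) (L L' : lieAlgType F)
    (g : {vspace L}) (g' : {vspace L'}) :=
  exists f : 'Hom(L, L'),
    [/\ (g :&: lker f = 0)%VS, (f @: g = g')%VS
      & forall x y, x \in g -> y \in g -> f (lie x y) = lie (f x) (f y)].

Section Iwasawa.
Variables (R : realType) (L : lieAlgType R).
Implicit Types (g k a n : {vspace L}) (theta : 'End(L)).

(* Only the restriction of theta to g matters.  The form
   (x, y) |-> - killing g x (theta y) has to be positive definite. *)
Definition is_cartan_involution g theta :=
  [/\ (theta @: g <= g)%VS,
      forall x, x \in g -> theta (theta x) = x,
      forall x y, x \in g -> y \in g ->
        theta (lie x y) = lie (theta x) (theta y)
    & forall x, x \in g -> x != 0 -> 0 < - killing g x (theta x)].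

Definition is_maximal_abelian_in (p a : {vspace L}) :=
  [/\ (a <= p)%VS, is_abelian a
    & forall b : {vspace L},
        (b <= p)%VS -> is_abelian b -> (a <= b)%VS -> b = a].

Definition dual a := 'Hom(subvs_of a, R^o).

Definition is_root_vector g a (lam : dual a) (x : L) :=
  x \in g /\ forall h : subvs_of a, lie (vsval h) x = (lam h : R) *: x.

Definition is_root g a (lam : dual a) :=
  lam != 0 /\ exists2 x, x != 0 & is_root_vector g lam x.

Definition is_positivity a (pos : dual a -> Prop) :=
  [/\ forall lam, lam != 0 -> pos lam \/ pos (- lam),
      forall lam, lam != 0 -> ~ (pos lam /\ pos (- lam)),
      forall lam mu, pos lam -> pos mu -> pos (lam + mu)
    & forall (c : R) lam, 0 < c -> pos lam -> pos (c *: lam)].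

Definition contains_positive_root_spaces g a (pos : dual a -> Prop) n :=
  forall lam x, is_root g lam -> pos lam -> is_root_vector g lam x -> x \in n.

(* The sum of the positive root spaces, as the least subspace containing all of
   them. *)
Definition is_positive_nilpotent g a (pos : dual a -> Prop) n :=
  contains_positive_root_spaces g pos n /\
  forall m, contains_positive_root_spaces g pos m -> (n <= m)%VS.

(* g is semisimple as soon as it has a Cartan involution in the above sense,
   since its Killing form is then nondegenerate. *)
Definition is_iwasawa_decomposition g k a n :=
  exists theta : 'End(L), exists pos : dual a -> Prop,
    [/\ is_cartan_involution g theta,
        k = (g :&: passmx.leigenspace theta 1)%VS,
        is_maximal_abelian_in (g :&: passmx.leigenspace theta (-1)) a,
        is_positivity pos /\ is_positive_nilpotent g pos n
      & g = (k + a + n)%VS /\ directv (k + a + n)].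

Definition is_iwasawa_component g (s : {vspace L}) :=
  exists k a n, is_iwasawa_decomposition g k a n /\ s = (a + n)%VS.

End Iwasawa.

Section MatrixLie.
Variables (F : fieldType) (n : nat).
Implicit Types (x y z : 'M[F]_n).

Definition mxlie x y := x *m y - y *m x.

Lemma mxlie_linearl z : linear (mxlie^~ z).
Proof.
move=> c x y; rewrite /mxlie mulmxDl mulmxDr -scalemxAl -scalemxAr scalerBr.
by rewrite opprD addrACA.
Qed.

Lemma mxlie_linearr x : linear (mxlie x).
Proof.
move=> c y z; rewrite /mxlie mulmxDl mulmxDr -scalemxAl -scalemxAr scalerBr.
by rewrite opprD addrACA.
Qed.

Lemma mxliexx x : mxlie x x = 0.
Proof. exact: subrr. Qed.

Lemma mxlie_jacobi x y z :
  mxlie x (mxlie y z) + mxlie y (mxlie z x) + mxlie z (mxlie x y) = 0.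
Proof.
rewrite /mxlie !mulmxBl !mulmxBr !mulmxA !opprB.
set a := x *m y *m z; set b := x *m z *m y; set c := y *m z *m x.
set d := z *m y *m x; set e := y *m x *m z; set f := z *m x *m y.
rewrite (_ : a - b + (d - c) = (a + d) - (b + c)); last first.
  by rewrite opprD addrACA.
rewrite (_ : c - e + (b - f) = (b + c) - (e + f)); last first.
  by rewrite opprD addrACA (addrC b).
rewrite (_ : f - d + (e - a) = (e + f) - (a + d)); last first.
  by rewrite opprD addrACA (addrC e) (addrC (- a)).
by rewrite !subrKA subrr.
Qed.

HB.instance Definition _ := isLieAlgebra.Build F 'M[F]_n
  mxlie_linearl mxlie_linearr mxliexx mxlie_jacobi.

End MatrixLie.

(* The n x n complex matrices as a Lie algebra over R. *)
Definition cmx (R : rcfType) (n : nat) : Type := 'M[R[i]]_n.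

Section ComplexMatrixLie.
Variables (R : rcfType) (n : nat).
Local Open Scope complex_scope.

HB.instance Definition _ := GRing.Zmodule.on (cmx R n).

Definition cmx_scale (c : R) (x : cmx R n) : cmx R n :=
  c%:C *: (x : 'M[R[i]]_n).

Fact cmx_scaleA (b c : R) x : cmx_scale b (cmx_scale c x) = cmx_scale (b * c) x.
Proof. by rewrite /cmx_scale scalerA rmorphM. Qed.
Fact cmx_scale1 : left_id 1 cmx_scale.
Proof. by move=> x; rewrite /cmx_scale rmorph1 scale1r. Qed.
Fact cmx_scaleDr : right_distributive cmx_scale +%R.
Proof. by move=> c x y; rewrite /cmx_scale scalerDr. Qed.
Fact cmx_scaleDl (x : cmx R n) :
  {morph (fun c => cmx_scale c x) : b c / b + c}.
Proof. by move=> b c; rewrite /cmx_scale rmorphD scalerDl. Qed.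

HB.instance Definition _ := GRing.Zmodule_isLmodule.Build R (cmx R n)
  cmx_scaleA cmx_scale1 cmx_scaleDr cmx_scaleDl.

Definition cmx_to_rV (x : cmx R n) : 'rV[R]_(n * n + n * n) :=
  row_mx (mxvec (map_mx (@complex.Re R) x)) (mxvec (map_mx (@complex.Im R) x)).

Definition cmx_of_rV (v : 'rV[R]_(n * n + n * n)) : cmx R n :=
  \matrix_(i, j) (vec_mx (lsubmx v) i j +i* vec_mx (rsubmx v) i j).

Fact cmx_to_rV_linear : linear cmx_to_rV.
Proof.
move=> c x y; rewrite /cmx_to_rV scale_row_mx add_row_mx -!linearP /=.
congr row_mx; congr mxvec; apply/matrixP => i j; rewrite !mxE;
  case: (x i j) (y i j) => [a b] [a' b'] /=; by rewrite mul0r ?subr0 ?addr0.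
Qed.

Fact cmx_to_rV_bij : bijective cmx_to_rV.
Proof.
exists cmx_of_rV => [x|v].
  apply/matrixP => i j.
  rewrite mxE row_mxKl row_mxKr !mxvecK !mxE; by case: (x i j).
rewrite /cmx_to_rV -[RHS]hsubmxK; congr row_mx;
  rewrite -[RHS]vec_mxK; congr mxvec; apply/matrixP => i j; by rewrite !mxE.
Qed.

Fact cmx_vector_axiom : Vector.axiom (n * n + n * n) (cmx R n).
Proof. by exists cmx_to_rV; [exact: cmx_to_rV_linear|exact: cmx_to_rV_bij]. Qed.

HB.instance Definition _ := Lmodule_hasFinDim.Build R (cmx R n)
  cmx_vector_axiom.

Fact cmxlie_linearl (z : cmx R n) :
  linear ((fun x y : cmx R n => mxlie x y : cmx R n)^~ z).
Proof. move=> c x y; exact: mxlie_linearl. Qed.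
Fact cmxlie_linearr (x : cmx R n) :
  linear (fun y : cmx R n => mxlie x y : cmx R n).
Proof. move=> c y z; exact: mxlie_linearr. Qed.

HB.instance Definition _ := isLieAlgebra.Build R (cmx R n)
  cmxlie_linearl cmxlie_linearr
  (@mxliexx R[i] n) (@mxlie_jacobi R[i] n).

End ComplexMatrixLie.

Definition Ipq (K : pzRingType) (p q : nat) : 'M[K]_(p + q) :=
  block_mx 1%:M 0 0 (- 1%:M).

Section Classical.
Variables (R : rcfType) (p q : nat).

Definition so_map (X : 'M[R]_(p + q)) : 'M[R]_(p + q) :=
  X^T *m Ipq R p q + Ipq R p q *m X.

Definition so : {vspace 'M[R]_(p + q)} := lker (linfun so_map).

Definition ctr (X : 'M[R[i]]_(p + q)) : 'M[R[i]]_(p + q) :=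
  map_mx (@conjc R) X^T.

Definition su_map (X : cmx R (p + q)) : cmx R (p + q) :=
  ctr X *m Ipq R[i] p q + Ipq R[i] p q *m (X : 'M_(p + q)).

Definition tr_map (X : cmx R (p + q)) : cmx R (p + q) :=
  (\tr (X : 'M[R[i]]_(p + q)))%:M.

Definition su : {vspace cmx R (p + q)} :=
  (lker (linfun su_map) :&: lker (linfun tr_map))%VS.

Fact so_map_linear : linear so_map.
Proof.
move=> c X Y; rewrite /so_map linearP /= mulmxDl mulmxDr.
by rewrite -scalemxAl -scalemxAr scalerDr addrACA.
Qed.
HB.instance Definition _ := GRing.isLinear.Build _ _ _ _ so_map so_map_linear.

Fact su_map_linear : linear su_map.
Proof.
move=> c X Y; rewrite /su_map /ctr.
have -> : map_mx (@conjc R) (c *: X + Y)^T =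
    real_complex R c *: map_mx (@conjc R) X^T + map_mx (@conjc R) Y^T.
  apply/matrixP => i j; rewrite !mxE.
  case: (X j i) (Y j i) => [a b] [a' b'] /=; by simpc.
rewrite mulmxDl mulmxDr -scalemxAl -scalemxAr.
have -> : c *: su_map X = real_complex R c *: (su_map X : 'M[R[i]]_(p + q)) by [].
by rewrite /su_map scalerDr addrACA.
Qed.
HB.instance Definition _ := GRing.isLinear.Build _ _ _ _ su_map su_map_linear.

Fact tr_map_linear : linear tr_map.
Proof.
move=> c X Y; rewrite /tr_map.
have -> : \tr (c *: X + Y : 'M[R[i]]_(p + q)) =
   real_complex R c * \tr (X : 'M_(p + q)) + \tr (Y : 'M_(p + q)).
  exact: (@linearP _ _ _ _ (@mxtrace R[i] (p + q))).
by rewrite raddfD /= -scale_scalar_mx.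
Qed.
HB.instance Definition _ := GRing.isLinear.Build _ _ _ _ tr_map tr_map_linear.

Lemma soP (X : 'M[R]_(p + q)) :
  reflect (X^T *m Ipq R p q + Ipq R p q *m X = 0) (X \in so).
Proof. by rewrite memv_ker lfunE; apply: eqP. Qed.

Lemma suP (X : cmx R (p + q)) :
  reflect (ctr X *m Ipq R[i] p q + Ipq R[i] p q *m (X : 'M_(p + q)) = 0 /\
           \tr (X : 'M[R[i]]_(p + q)) = 0)
          (X \in su).
Proof.
rewrite memv_cap !memv_ker !lfunE /=.
apply: (iffP andP) => [[/eqP h1 /eqP h2]|[h1 h2]]; split.
- exact: h1.
- move: h2; rewrite /tr_map; case: (p + q)%N X {h1} => [|m] X h.
    by rewrite /mxtrace big_ord0.
  by move/matrixP: h => /(_ ord0 ord0); rewrite !mxE eqxx mulr1n.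
- by apply/eqP; exact: h1.
- by apply/eqP; rewrite /tr_map h2 raddf0.
Qed.

End Classical.

(* Main.v *)
Require Import Defs.
From HB Require Import structures.
From mathcomp Require Import all_boot all_order all_algebra.
From mathcomp Require Import boolp reals.
From mathcomp Require Import complex ring.
Set Implicit Arguments.
Unset Strict Implicit.
Unset Printing Implicit Defensive.
Import Order.TTheory GRing.Theory Num.Theory.
Local Open Scope ring_scope.

(** The Iwasawa components of so(2, k + 2) and su(1, k + 1) are computed in
    coordinates, whatever the Cartan involution, the maximal abelian subspace
    [a] and the positive roots are.  The coordinates come from the standard
    representation V: a real or complex space with a Hermitian form of
    signature (r, r + k), where r is 2 or 1.

    For h in [a] the operator ad h is self-adjoint for the positive definite
    form given by the Cartan involution, so g is spanned by eigenvectors of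
    ad h with real eigenvalues ([ad_semisimple_p]).  These eigenvectors shift
    the eigenspaces of h in V by real numbers; as V is irreducible and h has
    trace zero, h is diagonalizable on V with real eigenvalues
    ([ad_semisimple_standard]).  The elements of [a] commute, so V has a basis
    of common eigenvectors, and a common eigenvector of nonzero weight is
    isotropic.  Hence V has a basis e_i, f_i, w_l, made of r hyperbolic pairs
    and of k orthonormal negative vectors, in which every h in [a] is
    diag(t, -t, 0) with t real ([witt_basis]).  Conversely each diag(t, -t, 0)
    commutes with [a] and is real diagonalizable on g; its component fixed by
    the Cartan involution is then central, hence zero, and maximality puts it
    into [a] ([max_split], [torus_in_a]).  So [a] is the whole torus and its
    roots eps_i - eps_j, +-(eps_i + eps_j), +-eps_i can be read off the matrix
    entries.  Exchanging e_i and f_i where eps_i is negative, one finds that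
    a + n consists of the block matrices [parabolic_mx A B C] with A
    triangular of real diagonal, B skew-Hermitian and C arbitrary
    ([iwasawa_component_borel]).

    For r = 1 this algebra is a Heisenberg algebra of dimension 2k + 1 extended
    by a grading element ([heis], [su_heis]).  For r = 2 the upper triangular A
    is the sum of a matrix with rows (t, b), (0, -t) and of a scalar matrix:
    the former, with B = C = 0, form a subalgebra of type [heis 0], while the
    scalar A together with all B and C form an ideal of type [heis k]
    ([so_components]).  These are the models found for su(1, 1) and
    su(1, k + 1). *)

(** * Invariance of the Killing form *)

Section Killing.
Variables (F : fieldType) (L : lieAlgType F).
Implicit Types (g : {vspace L}) (x y z : L).

Lemma lieDl x y z : lie (x + y) z = lie x z + lie y z.
Proof. by have := lie_linearl z 1 x y; rewrite !scale1r. Qed.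
Lemma lieDr x y z : lie z (x + y) = lie z x + lie z y.
Proof. by have := lie_linearr z 1 x y; rewrite !scale1r. Qed.
Lemma lie0l z : lie 0 z = 0.
Proof. by apply: (addrI (lie 0 z)); rewrite -lieDl !addr0. Qed.
Lemma lie0r z : lie z 0 = 0.
Proof. by apply: (addrI (lie z 0)); rewrite -lieDr !addr0. Qed.
Lemma lieZl c x z : lie (c *: x) z = c *: lie x z.
Proof. by have := lie_linearl z c x 0; rewrite lie0l !addr0. Qed.
Lemma lieZr c x z : lie z (c *: x) = c *: lie z x.
Proof. by have := lie_linearr z c x 0; rewrite lie0r !addr0. Qed.
Lemma lieNl x z : lie (- x) z = - lie x z.
Proof. by rewrite -scaleN1r lieZl scaleN1r. Qed.
Lemma lieNr x z : lie z (- x) = - lie z x.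
Proof. by rewrite -scaleN1r lieZr scaleN1r. Qed.
Lemma lieBr x y z : lie z (x - y) = lie z x - lie z y.
Proof. by rewrite lieDr lieNr. Qed.
Lemma lie_sumr (I : finType) (f : I -> L) z :
  lie z (\sum_i f i) = \sum_i lie z (f i).
Proof. exact: (big_morph _ (fun x y => lieDr x y z) (lie0r z)). Qed.
Lemma lieC x y : lie x y = - lie y x.
Proof.
apply/eqP; rewrite -addr_eq0; have := liexx (x + y).
by rewrite lieDl !lieDr !liexx add0r addr0 => ->.
Qed.
Lemma lie_lie x y z : lie (lie x y) z = lie x (lie y z) - lie y (lie x z).
Proof.
apply/eqP; rewrite (lieC (lie x y)) (lieC x z) lieNr opprK -subr_eq0 -opprD.
by rewrite oppr_eq0 addrC lie_jacobi.
Qed.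

Definition coord_row g x : 'rV[F]_(\dim g) := \row_i coord (vbasis g) i x.

(** Coordinates are rows and [ad_mx] acts on their right, so that the matrix of
    a product of operators is the product in the reverse order. *)
Definition ad_mx g x : 'M[F]_(\dim g) :=
  \matrix_(i, j) coord (vbasis g) j (lie x (vbasis g)`_i).

Lemma coord_row_inj g : {in g &, injective (coord_row g)}.
Proof.
move=> x y gx gy /rowP e; rewrite (coord_vbasis gx) (coord_vbasis gy).
by apply: eq_bigr => i _; have := e i; rewrite !mxE => ->.
Qed.

Lemma coord_row_linear g : linear (coord_row g).
Proof. by move=> c x y; apply/rowP => i; rewrite !mxE linearP. Qed.
HB.instance Definition _ g :=
  GRing.isLinear.Build _ _ _ _ (coord_row g) (coord_row_linear g).

Lemma coord_row_lie g x v : v \in g ->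
  coord_row g (lie x v) = coord_row g v *m ad_mx g x.
Proof.
move=> gv; apply/rowP => j; rewrite !mxE {1}(coord_vbasis gv) lie_sumr linear_sum.
by apply: eq_bigr => i _; rewrite lieZr linearZ !mxE.
Qed.

Variable g : {vspace L}.
Hypothesis gS : is_subalgebra g.

Lemma row_ad_mx x i : row i (ad_mx g x) = coord_row g (lie x (vbasis g)`_i).
Proof. by apply/rowP => j; rewrite !mxE. Qed.

Lemma vbasis_nth_mem (i : 'I_(\dim g)) : (vbasis g)`_i \in g.
Proof. by apply/vbasis_mem/mem_nth; rewrite size_tuple. Qed.

Lemma killingE x y : y \in g -> killing g x y = \tr (ad_mx g y *m ad_mx g x).
Proof.
move=> gy; apply: eq_bigr => i _.
have -> : coord (vbasis g) i (lie x (lie y (vbasis g)`_i)) =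
   coord_row g (lie x (lie y (vbasis g)`_i)) 0 i by rewrite mxE.
rewrite coord_row_lie -?row_ad_mx; last exact/gS/vbasis_nth_mem.
by rewrite -row_mul mxE.
Qed.

Lemma ad_mx_lie x y : x \in g -> y \in g ->
  ad_mx g (lie x y) = ad_mx g y *m ad_mx g x - ad_mx g x *m ad_mx g y.
Proof.
move=> gx gy; apply/row_matrixP => i.
have gi := vbasis_nth_mem i.
by rewrite linearB /= !row_mul !row_ad_mx -!coord_row_lie ?gS // -linearB -lie_lie.
Qed.

(** Both sides are traces of products of three operators that agree up to a
    cyclic permutation. *)
Lemma killing_lie x y z : x \in g -> y \in g -> z \in g ->
  killing g (lie x y) z = killing g x (lie y z).
Proof.
move=> gx gy gz; rewrite !killingE ?gS // !ad_mx_lie // mulmxBr mulmxBl.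
by rewrite !(raddfB (@mxtrace F _)) !mulmxA [X in _ - X = _]mxtrace_mulC !mulmxA.
Qed.

Lemma killingDl x x' y : killing g (x + x') y = killing g x y + killing g x' y.
Proof. by rewrite -big_split; apply: eq_bigr => i _; rewrite lieDl linearD. Qed.
Lemma killingDr x y y' : killing g x (y + y') = killing g x y + killing g x y'.
Proof. by rewrite -big_split; apply: eq_bigr => i _; rewrite lieDl lieDr linearD. Qed.
Lemma killingZl c x y : killing g (c *: x) y = c * killing g x y.
Proof. by rewrite mulr_sumr; apply: eq_bigr => i _; rewrite lieZl linearZ. Qed.
Lemma killingZr c x y : killing g x (c *: y) = c * killing g x y.
Proof. by rewrite mulr_sumr; apply: eq_bigr => i _; rewrite lieZl lieZr linearZ. Qed.

End Killing.

(** * Real spectral theorem *)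

Section RealSpectral.
Variable R : rcfType.
Local Notation C := R[i].

Lemma complex_real_embed (z : C) : complex.Im z = 0 -> z = (complex.Re z)%:C%C.
Proof. by case: z => a b /= ->. Qed.

(** The vectors x and y are the real and imaginary parts of an eigenvector. *)
Lemma eigenvalue_map_complex n (M : 'M[R]_n) z :
  eigenvalue (map_mx (real_complex R) M) z ->
  exists x y : 'rV[R]_n,
    [/\ (x != 0) || (y != 0),
        x *m M = complex.Re z *: x - complex.Im z *: y
      & y *m M = complex.Im z *: x + complex.Re z *: y].
Proof.
case/eigenvalueP => v Mv v0.
pose x := map_mx (@complex.Re R) v; pose y := map_mx (@complex.Im R) v.
exists x, y; split.
- rewrite -negb_and; apply: contra v0 => /andP [/eqP x0 /eqP y0].
  apply/eqP/rowP => j; move/rowP/(_ j): x0; move/rowP/(_ j): y0.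
  by rewrite !mxE; case: (v 0 j) => a b /= -> ->.
- apply/rowP => j; move/rowP/(_ j)/(congr1 (@complex.Re R)): Mv.
  rewrite !mxE (raddf_sum (@complex.Re R)) => e.
  transitivity (complex.Re (z * v 0 j)).
    by rewrite -e; apply: eq_bigr => k _; rewrite !mxE; case: (v 0 k) => a b;
      rewrite /= mulr0 subr0.
  by case: (z) (v 0 j) => a b [c d].
- apply/rowP => j; move/rowP/(_ j)/(congr1 (@complex.Im R)): Mv.
  rewrite !mxE (raddf_sum (@complex.Im R)) => e.
  transitivity (complex.Im (z * v 0 j)).
    by rewrite -e; apply: eq_bigr => k _; rewrite !mxE; case: (v 0 k) => a b;
      rewrite /= mulr0 add0r.
  by case: (z) (v 0 j) => a b [c d] /=; rewrite addrC.
Qed.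

Lemma split_real_poly (p : {poly R}) : p \is monic ->
  (forall z : C, root (map_poly (real_complex R) p) z -> complex.Im z = 0) ->
  exists rs, p = \prod_(r <- rs) ('X - r%:P).
Proof.
move=> pm rts; have [s es] := closed_field_poly_normal (map_poly (real_complex R) p).
exists (map (@complex.Re R) s).
apply: (map_poly_inj (real_complex R)); rewrite [LHS]es lead_coef_map (monicP pm).
rewrite rmorph1 scale1r big_map rmorph_prod /= !big_seq; apply: eq_bigr => z zs.
rewrite rmorphB /= map_polyX map_polyC /= -complex_real_embed //.
by apply: rts; rewrite es lead_coef_map (monicP pm) rmorph1 scale1r root_prod_XsubC.
Qed.

Variables (n : nat) (G M : 'M[R]_n).
Hypothesis Gpos : forall v : 'rV[R]_n, v != 0 -> 0 < (v *m G *m v^T) 0 0.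
Hypothesis MG : M *m G = G *m M^T.

Let form0 (v : 'rV[R]_n) : (v *m G *m v^T) 0 0 = 0 -> v = 0.
Proof. by move=> v0; apply/eqP; apply: contraT => /Gpos; rewrite v0 ltxx. Qed.

(** With an eigenvector x + iy for a + ib, comparing the forms of (xM, y) and of
    (x, yM) gives b times the sum of the squared norms of x and y. *)
Lemma selfadjoint_eigenvalue_real z :
  eigenvalue (map_mx (real_complex R) M) z -> complex.Im z = 0.
Proof.
case/eigenvalue_map_complex => x [y [xy0 xM yM]].
have e : x *m M *m G *m y^T = x *m G *m (y *m M)^T.
  by rewrite -[x *m M *m G]mulmxA MG trmx_mul !mulmxA.
rewrite {}xM {}yM in e; move/matrixP/(_ 0 0): e.
rewrite mulmxBl linearD /= !linearZ /= mulmxDr !mulmxBl -!scalemxAl -!scalemxAr.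
rewrite !mxE [RHS]addrC => /addrI e.
have ge0 (v : 'rV[R]_n) : 0 <= (v *m G *m v^T) 0 0.
  by have [->|/Gpos/ltW//] := eqVneq v 0; rewrite mul0mx mul0mx mxE.
have : complex.Im z * ((x *m G *m x^T) 0 0 + (y *m G *m y^T) 0 0) = 0.
  by rewrite mulrDr !mxE -e addNr.
move/eqP; rewrite mulf_eq0 => /orP[/eqP//|].
rewrite paddr_eq0 // => /andP[/eqP/form0 x0 /eqP/form0 y0].
by rewrite x0 y0 eqxx in xy0.
Qed.

(** The norm of w = v(M - a) is the form of v and w(M - a). *)
Lemma selfadjoint_kernel (a : R) m (V : 'M_(m, n)) :
  V *m (M - a%:M) *m (M - a%:M) = 0 -> V *m (M - a%:M) = 0.
Proof.
move=> e; apply/row_matrixP => i; rewrite row0; apply: form0.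
set w := row i _; rewrite {1}/w row_mul -[row i V *m _ *m G]mulmxA.
have -> : (M - a%:M) *m G = G *m (M - a%:M)^T.
  by rewrite mulmxBl linearB /= mulmxBr MG tr_scalar_mx scalar_mxC.
have w0 : w *m (M - a%:M) = 0 by rewrite -row_mul e row0.
by rewrite mulmxA -mulmxA -trmx_mul w0 trmx0 mulmx0 mxE.
Qed.

End RealSpectral.

(** The minimal polynomial splits over R because the complex eigenvalues are
    real, and a double root would contradict its minimality because M - a and
    its square have the same kernel. *)
Theorem selfadjoint_diagonalizable (R : rcfType) n (G M : 'M[R]_n) :
  (forall v : 'rV[R]_n, v != 0 -> 0 < (v *m G *m v^T) 0 0) ->
  M *m G = G *m M^T -> diagonalizable M.
Proof.
case: n G M => [|n] G M Gpos MG.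
  by rewrite (flatmx0 M); apply: diagonalizable0.
apply/diagonalizableP.
have [|rs ers] := @split_real_poly R (mxminpoly M) (mxminpoly_monic M).
  move=> z; rewrite -mxminpoly_map -eigenvalue_root_min.
  exact: (selfadjoint_eigenvalue_real Gpos MG).
exists rs; last by rewrite -ers dvdpp.
apply/count_mem_uniq => a; have [ars|/count_memPn//] := boolP (a \in rs).
have /permP/(_ (pred1 a)) -> := perm_to_rem ars.
rewrite /= eqxx; have [a2|/count_memPn->//] := boolP (a \in rem a rs).
pose q := \prod_(r <- rem a (rem a rs)) ('X - r%:P).
have e1 : \prod_(r <- rem a rs) ('X - r%:P) = q * ('X - a%:P).
  by rewrite (perm_big _ (perm_to_rem a2)) big_cons mulrC.
have e2 : mxminpoly M = q * ('X - a%:P) * ('X - a%:P).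
  by rewrite [LHS]ers (perm_big _ (perm_to_rem ars)) big_cons e1 [LHS]mulrC.
have hX : horner_mx M ('X - a%:P) = M - a%:M.
  by rewrite rmorphB /= horner_mx_X horner_mx_C.
have /mxminpoly_min/dvdp_leq : horner_mx M (q * ('X - a%:P)) = 0.
  have := mx_root_minpoly M; rewrite e2 !rmorphM /= hX -!mulmxE.
  exact: (selfadjoint_kernel Gpos MG).
have q1 : q * ('X - a%:P) \is monic.
  by rewrite monicMl ?monicXsubC // monic_prod_XsubC.
move=> /(_ (monic_neq0 q1)).
by rewrite e2 size_Mmonic ?monic_neq0 ?monicXsubC // size_XsubC addn2 /= ltnn.
Qed.

(** * Consequences of a Cartan involution *)

Section CartanInvolution.
Variables (R : realType) (L : lieAlgType R) (g : {vspace L}) (theta : 'End(L)).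
Hypothesis gS : is_subalgebra g.
Hypothesis thetaC : is_cartan_involution g theta.
Implicit Types x y z h : L.

Lemma cartan_mem x : x \in g -> theta x \in g.
Proof. by case: thetaC => thg _ _ _ gx; apply: (subvP thg); apply: memv_img. Qed.

(** The sum of two copies of the form attached to the Cartan involution, the
    second one with its arguments exchanged: it is positive definite on g and
    visibly symmetric. *)
Definition cartan_form x y : R :=
  - (killing g x (theta y) + killing g y (theta x)).

Lemma cartan_formC x y : cartan_form x y = cartan_form y x.
Proof. by rewrite /cartan_form addrC. Qed.
Lemma cartan_formDl x x' y :
  cartan_form (x + x') y = cartan_form x y + cartan_form x' y.
Proof.
by rewrite /cartan_form linearD /= killingDl killingDr addrACA opprD.
Qed.
Lemma cartan_formZl c x y : cartan_form (c *: x) y = c * cartan_form x y.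
Proof. by rewrite /cartan_form linearZ /= killingZl killingZr -mulrDr mulrN. Qed.
Lemma cartan_formBl x x' y :
  cartan_form (x - x') y = cartan_form x y - cartan_form x' y.
Proof. by rewrite cartan_formDl -scaleN1r cartan_formZl mulN1r. Qed.
Lemma cartan_form0l y : cartan_form 0 y = 0.
Proof. by rewrite -(scale0r 0) cartan_formZl mul0r. Qed.
Lemma cartan_form_suml (I : finType) (f : I -> L) y :
  cartan_form (\sum_i f i) y = \sum_i cartan_form (f i) y.
Proof.
exact: (big_morph (cartan_form^~ y) (fun a b => cartan_formDl a b y)
  (cartan_form0l y)).
Qed.

Lemma cartan_form_gt0 x : x \in g -> x != 0 -> 0 < cartan_form x x.
Proof.
move=> gx x0; case: thetaC => _ _ _ /(_ x gx x0).
by rewrite /cartan_form opprD => pos; apply: addr_gt0.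
Qed.
Lemma cartan_form_eq0 x : x \in g -> cartan_form x x = 0 -> x = 0.
Proof.
move=> gx e; apply/eqP; apply: contraT => /(cartan_form_gt0 gx).
by rewrite e ltxx.
Qed.

(** Invariance of the Killing form, combined with theta h = - h. *)
Lemma killing_selfadjoint h x y : h \in g -> theta h = - h -> x \in g -> y \in g ->
  killing g (lie h x) (theta y) = killing g x (theta (lie h y)).
Proof.
case: thetaC => _ _ thetaM _ gh hth gx gy.
rewrite (thetaM h) // hth lieNl (lieC h x) -[- lie x h]scaleN1r killingZl.
by rewrite killing_lie ?cartan_mem // -[- lie h _]scaleN1r killingZr.
Qed.

Lemma cartan_form_selfadjoint h x y :
  h \in g -> theta h = - h -> x \in g -> y \in g ->
  cartan_form (lie h x) y = cartan_form x (lie h y).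
Proof.
move=> gh hth gx gy; rewrite /cartan_form killing_selfadjoint //.
by rewrite -(killing_selfadjoint gh hth gy gx).
Qed.

Lemma killing_skew k x y : k \in g -> theta k = k -> x \in g -> y \in g ->
  killing g (lie k x) (theta y) = - killing g x (theta (lie k y)).
Proof.
case: thetaC => _ _ thetaM _ gk kth gx gy.
rewrite (thetaM k) // kth (lieC k x) -[- lie x k]scaleN1r killingZl.
by rewrite killing_lie ?cartan_mem // mulN1r.
Qed.

Lemma cartan_form_skew k x y :
  k \in g -> theta k = k -> x \in g -> y \in g ->
  cartan_form (lie k x) y = - cartan_form x (lie k y).
Proof.
move=> gk kth gx gy; rewrite /cartan_form killing_skew //.
by rewrite -[X in - _ + X]opprK -(killing_skew gk kth gy gx) !opprD !opprK.
Qed.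

(** Diagonalizability of ad z on g over the reals. *)
Definition ad_semisimple z := forall x, x \in g ->
  exists m (E : 'I_m -> L) (c : 'I_m -> R), x = \sum_i E i /\
    forall i, E i \in g /\ lie z (E i) = c i *: E i.

Lemma ad_semisimple_p h : h \in g -> theta h = - h -> ad_semisimple h.
Proof.
move=> gh hth.
pose vec (w : 'rV[R]_(\dim g)) := \sum_i w 0 i *: (vbasis g)`_i.
pose G : 'M[R]_(\dim g) := \matrix_(i, j) cartan_form (vbasis g)`_i (vbasis g)`_j.
have vecg w : vec w \in g.
  by apply: memv_suml => i _; apply/memvZ/vbasis_nth_mem.
have vecK w : coord_row g (vec w) = w.
  apply/rowP => i; rewrite mxE coord_sum_free //.
  exact: (basis_free (vbasisP g)).
have vecE x : x \in g -> vec (coord_row g x) = x.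
  by move=> gx; apply: (coord_row_inj (vecg _) gx); rewrite vecK.
have lie_vec w : lie h (vec w) = vec (w *m ad_mx g h).
  by rewrite -[LHS]vecE ?gS // coord_row_lie // vecK.
have rowG w i : (w *m G) 0 i = cartan_form (vec w) (vbasis g)`_i.
  rewrite mxE cartan_form_suml; apply: eq_bigr => j _.
  by rewrite cartan_formZl mxE.
have [|| P Pu /diagonalizable_forPex[D /(simmxPp _) PD]] :=
    @selfadjoint_diagonalizable _ _ G (ad_mx g h).
- move=> w w0; have -> : (w *m G *m w^T) 0 0 = cartan_form (vec w) (vec w).
    rewrite [X in cartan_form X _]/vec cartan_form_suml mxE.
    by apply: eq_bigr => i _; rewrite rowG cartan_formZl cartan_formC !mxE mulrC.
  apply: cartan_form_gt0 => //; apply: contraNneq w0 => /(congr1 (coord_row g)).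
  by rewrite vecK => ->; rewrite linear0.
- apply/matrixP => i j.
  have bE (k : 'I_(\dim g)) : (vbasis g)`_k = vec (delta_mx 0 k).
    rewrite /vec (bigD1 k) //= mxE !eqxx scale1r big1 ?addr0 // => k' nk.
    by rewrite mxE (negPf nk) scale0r.
  have -> : (ad_mx g h *m G) i j = (row i (ad_mx g h) *m G) 0 j.
    by rewrite -row_mul [RHS]mxE.
  have -> : (G *m (ad_mx g h)^T) i j = (row j (ad_mx g h) *m G) 0 i.
    rewrite -row_mul [RHS]mxE [LHS]mxE [RHS]mxE; apply: eq_bigr => k _.
    by rewrite mulrC !mxE cartan_formC.
  rewrite !rowG !rowE -!lie_vec -!bE cartan_form_selfadjoint ?vbasis_nth_mem //.
  exact: cartan_formC.
move=> x gx; pose u := coord_row g x *m invmx P.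
exists (\dim g), (fun i => u 0 i *: vec (row i P)), (fun i => D 0 i); split.
  rewrite -{1}[x]vecE // -[coord_row g x](mulmxKV Pu) -/u.
  under [RHS]eq_bigr => i _ do rewrite scaler_sumr.
  rewrite exchange_big /=; apply: eq_bigr => j _.
  by rewrite mxE scaler_suml; apply: eq_bigr => i _; rewrite !mxE scalerA.
move=> i; split; first exact: memvZ.
have rP : row i P *m ad_mx g h = D 0 i *: row i P.
  by rewrite -row_mul PD ?stablemx_unit //; apply/rowP => j; rewrite mul_diag_mx !mxE.
have vecZ c w : vec (c *: w) = c *: vec w.
  by rewrite /vec scaler_sumr; apply: eq_bigr => j _; rewrite mxE scalerA.
by rewrite lieZr lie_vec rP vecZ !scalerA mulrC.
Qed.

(** A central element is orthogonal to everything for the Killing form. *)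
Lemma cartan_lie_center y : y \in g -> (forall x, x \in g -> lie y x = 0) -> y = 0.
Proof.
move=> gy yc; apply: cartan_form_eq0 => //.
have k0 : killing g y (theta y) = 0; last by rewrite /cartan_form k0 addr0 oppr0.
apply: big1 => i _; rewrite yc ?linear0 ?gS ?cartan_mem //.
exact: vbasis_nth_mem.
Qed.

Variables (p a : {vspace L}).
Hypothesis pE : p = (g :&: passmx.leigenspace theta (-1))%VS.
Hypothesis aM : is_maximal_abelian_in p a.

Lemma cartan_pP x : reflect (x \in g /\ theta x = - x) (x \in p).
Proof.
rewrite pE memv_cap memv_ker !lfunE /= opp_lfunE !lfunE /= scaleN1r opprK.
by rewrite id_lfunE addr_eq0; apply: (iffP andP) => [[gx /eqP]|[gx /eqP]].
Qed.

(** The span of a and h is again abelian. *)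
Lemma max_abelian_centralizer h : h \in p -> (forall x, x \in a -> lie x h = 0) ->
  h \in a.
Proof.
case: aM => ap aA amax ph hc.
have <- : (a + <[h]>)%VS = a; last by rewrite (subvP (addvSr _ _)) ?memv_line.
apply: amax; last exact: addvSl.
  by rewrite subv_add ap -memvE.
move=> x y /memv_addP[x1 ax1 [_ /vlineP[c ->] ->]] /memv_addP[y1 ay1 [_ /vlineP[d ->] ->]].
rewrite lieDl !lieDr !lieZl !lieZr aA // hc // liexx lieC hc //.
by rewrite !scaler0 oppr0 scaler0 !addr0.
Qed.

(** Write z = h + k with theta h = - h and theta k = k.  Then h centralizes a,
    so h lies in a and commutes with z and k.  On an eigenvector y of ad z the
    operator ad k is ad z - ad h, where ad k is skew, ad h self-adjoint and both
    commute; this forces [k, y] = 0.  Such vectors span g, so k is central. *)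
Lemma max_split z : z \in g -> (forall x, x \in a -> lie x z = 0) ->
  ad_semisimple z -> z \in a.
Proof.
move=> gz zc zss; case: (aM) => ap aA _.
have ag x : x \in a -> x \in g /\ theta x = - x by move/(subvP ap)/cartan_pP.
have [_ thK thM _] := thetaC.
pose h := 2^-1 *: (z - theta z); pose k := 2^-1 *: (z + theta z).
have zE : z = h + k.
  rewrite -scalerDr addrACA addNr addr0 -mulr2n -[z *+ 2]scaler_nat scalerA.
  by rewrite mulVf ?pnatr_eq0 // scale1r.
have gtz := cartan_mem gz.
have gh : h \in g by apply/memvZ/rpredB.
have gk : k \in g by apply/memvZ/rpredD.
have thh : theta h = - h by rewrite /h linearZ linearB /= thK // -scalerN opprB.
have thk : theta k = k by rewrite /k linearZ linearD /= thK // addrC.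
have ah : h \in a.
  apply: max_abelian_centralizer; first exact/cartan_pP.
  move=> x ax; have [gx thx] := ag x ax.
  have e : lie x (theta z) = 0.
    by apply: oppr_inj; rewrite oppr0 -lieNl -thx -thM // zc // linear0.
  by rewrite lieZr lieBr zc // e subr0 scaler0.
have hk : lie h k = 0.
  have -> : k = z - h by rewrite zE addrAC subrr add0r.
  by rewrite lieBr zc // liexx subr0.
suff k0 : k = 0 by rewrite zE k0 addr0.
apply: cartan_lie_center => // x gx; have [m [E [c [-> Ec]]]] := zss x gx.
rewrite lie_sumr big1 // => i _; have [gE zEi] := Ec i.
apply: cartan_form_eq0; first exact: gS.
have e1 : cartan_form (E i) (lie k (E i)) = 0.
  by apply/eqP; rewrite -eqNr -cartan_form_skew // cartan_formC.
have e2 : cartan_form (lie h (E i)) (lie k (E i)) = 0.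
  apply/eqP; rewrite -eqNr; apply/eqP.
  have kh : lie h (lie k (E i)) = lie k (lie h (E i)).
    by apply/eqP; rewrite -subr_eq0 -lie_lie hk lie0l.
  rewrite [RHS]cartan_form_selfadjoint ?gS // kh.
  by apply: oppr_inj; rewrite opprK -cartan_form_skew ?gS // cartan_formC.
have {1}-> : lie k (E i) = c i *: E i - lie h (E i).
  by rewrite -zEi zE lieDl addrAC subrr add0r.
by rewrite cartan_formBl cartan_formZl e1 e2 mulr0 subr0.
Qed.

End CartanInvolution.

(** * From the adjoint to the standard representation *)

Section StandardRepresentation.
Variables (R : realType) (L : lieAlgType R) (g : {vspace L}) (n : nat).
Local Notation C := R[i].
Variable rho : L -> 'M[C]_n.+1.
Hypothesis rhoD : forall x y, rho (x + y) = rho x + rho y.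
Hypothesis rhoZ : forall c x, rho (c *: x) = real_complex R c *: rho x.
Hypothesis rho_lie : forall x y, rho (lie x y) = mxlie (rho x) (rho y).
Hypothesis rho_irr : forall U : 'M[C]_n.+1,
  (forall x, x \in g -> (U *m rho x <= U)%MS) -> U != 0 -> (1%:M <= U)%MS.

(** On rows, an eigenvector E of ad A for c maps the z-eigenspace of A to the
    eigenspace for z - c. *)
Lemma eigenvector_shift (A E W : 'M[C]_n.+1) z (c : C) :
  mxlie A E = c *: E -> W *m A = z *: W -> W *m E *m A = (z - c) *: (W *m E).
Proof.
move=> AE WA; rewrite -mulmxA.
have -> : E *m A = A *m E - c *: E by rewrite -AE /mxlie opprB addrCA subrr addr0.
by rewrite mulmxBr mulmxA WA -scalemxAl -scalemxAr scalerBl.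
Qed.

Lemma eigenvector_kill (A : 'M[C]_n.+1) m (W : 'M[C]_(m, n.+1)) z s :
  W *m A = z *: W -> z \in s -> W *m horner_mx A (\prod_(r <- s) ('X - r%:P)) = 0.
Proof.
move=> WA zs; rewrite (perm_big _ (perm_to_rem zs)) big_cons rmorphM /=.
rewrite -mulmxE mulmxA rmorphB /= horner_mx_X horner_mx_C mulmxBr WA.
by rewrite mul_mx_scalar subrr mul0mx.
Qed.

(** The sum U of the eigenspaces of h whose eigenvalue has a fixed imaginary
    part is stable, because eigenvectors of ad h shift eigenvalues by real
    numbers.  By irreducibility U is everything: h is diagonalizable and all
    eigenvalues have this imaginary part, which is zero as the trace vanishes. *)
Theorem ad_semisimple_standard h : h \in g -> \tr (rho h) = 0 -> ad_semisimple g h ->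
  exists2 rs : seq R, uniq rs &
    mxminpoly (rho h) %| \prod_(r <- rs) ('X - (real_complex R r)%:P).
Proof.
move=> gh trh hss; set A := rho h.
have [s es] := closed_field_poly_normal (char_poly A).
rewrite (monicP (char_poly_monic A)) scale1r in es.
have szs : size s = n.+1.
  by apply: succn_inj; rewrite -(size_prod_XsubC s id) -es size_char_poly.
have evs z : eigenvalue A z = (z \in s).
  by rewrite eigenvalue_root_char es root_prod_XsubC.
pose c0 := s`_0; pose P (z : C) := complex.Im z == complex.Im c0.
have c0s : c0 \in s by rewrite mem_nth // szs.
pose U := (\sum_(i < size s | P s`_i) eigenspace A s`_i)%MS.
have subU z : P z -> (eigenspace A z <= U)%MS.
  move=> Pz; have [->|nz] := eqVneq (eigenspace A z) 0; first exact: sub0mx.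
  have zs : z \in s by rewrite -evs.
  have lt : (index z s < size s)%N by rewrite index_mem.
  by apply: (sumsmx_sup (Ordinal lt)); rewrite /= nth_index.
have U0 : U != 0.
  have : eigenspace A c0 != 0 by rewrite -[_ != 0]/(eigenvalue A c0) evs.
  by apply: contraNneq => U0; rewrite -submx0 -U0 subU // /P eqxx.
have Ustable x : x \in g -> (U *m rho x <= U)%MS.
  move=> gx; have [m [E [c [-> Ec]]]] := hss x gx.
  have -> : rho (\sum_i E i) = \sum_i rho (E i).
    apply: (big_morph rho rhoD).
    by apply: (addrI (rho 0)); rewrite -rhoD !addr0.
  rewrite mulmx_sumr; apply: summx_sub => i _; have [gE hE] := Ec i.
  rewrite sumsmxMr; apply/sumsmx_subP => j Pj.
  apply: submx_trans (subU (s`_j - real_complex R (c i)) _); last first.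
    by move: Pj; rewrite /P; case: (s`_j) => a b /=; rewrite subr0.
  apply/eigenspaceP; apply: eigenvector_shift.
    by rewrite -rho_lie hE rhoZ.
  exact/eigenspaceP.
have U1 := rho_irr Ustable U0.
pose t := undup (filter P s).
have pA : horner_mx A (\prod_(r <- t) ('X - r%:P)) = 0.
  rewrite -[LHS]mul1mx; apply/eqP; rewrite -sub_kermx.
  apply: submx_trans U1 _; apply/sumsmx_subP => i Pi; rewrite sub_kermx.
  apply/eqP/(@eigenvector_kill _ _ _ s`_i); first exact/eigenspaceP.
  by rewrite mem_undup mem_filter Pi mem_nth.
have dvd := mxminpoly_min pA.
have allP z : z \in s -> P z.
  rewrite -evs eigenvalue_root_min => rz.
  have : root (\prod_(r <- t) ('X - r%:P)) z.
    by have /dvdpP[q ->] := dvd; rewrite rootM rz orbT.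
  by rewrite root_prod_XsubC mem_undup mem_filter => /andP[].
have Im0 : complex.Im c0 = 0.
  have e : \sum_(z <- s) z = 0.
    apply: oppr_inj; rewrite oppr0 -coefPn_prod_XsubC ?szs // -es.
    by rewrite (@char_poly_trace _ n.+1) // trh oppr0.
  have /(congr1 (@complex.Im R)) := e; rewrite (raddf_sum (@complex.Im R)) /=.
  rewrite big_seq (eq_bigr (fun=> complex.Im c0)) => [|z /allP/eqP //].
  rewrite -big_seq big_const_seq count_predT szs iter_addr addr0 => /eqP.
  by rewrite mulrn_eq0 => /eqP.
have tIm z : z \in t -> complex.Im z = 0.
  by rewrite mem_undup mem_filter => /andP[/eqP-> _].
exists (map (@complex.Re R) t).
  rewrite map_inj_in_uniq ?undup_uniq // => y z yt zt e.
  by rewrite (complex_real_embed (tIm y yt)) (complex_real_embed (tIm z zt)) e.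
rewrite big_map big_seq; under eq_bigr => z zt.
  rewrite (_ : real_complex R _ = z); last by rewrite [RHS](complex_real_embed (tIm z zt)).
  over.
by rewrite -big_seq.
Qed.

End StandardRepresentation.

(** * Hermitian forms and Witt bases *)

(** The field K with its involution sg stands for R with the identity or for C
    with the conjugation; [sgE] makes sg x = x for real x. *)
Section Adjoint.
Variables (K : numFieldType) (sg : {rmorphism K -> K}).
Hypothesis sgE : forall x, x * sg x = `|x| ^+ 2.

Lemma sg_real x : x \is Num.real -> sg x = x.
Proof.
move=> xr; have [->|x0] := eqVneq x 0; first exact: rmorph0.
by apply: (mulfI x0); rewrite sgE real_normK.
Qed.

Lemma sgK : involutive sg.
Proof.
move=> x; have [->|x0] := eqVneq x 0; first by rewrite !rmorph0.
have sx0 : sg x != 0 by rewrite fmorph_eq0.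
apply: (mulfI sx0); rewrite -rmorphM sgE [LHS]sg_real ?realX ?normr_real //.
by rewrite -sgE mulrC.
Qed.

Lemma sg_fixed_real x : sg x = x -> x \is Num.real.
Proof.
move=> e; have /eqP := sgE x; rewrite e -expr2 eqf_sqr => /orP[]/eqP->; rewrite ?realN;
  exact: normr_real.
Qed.

Definition adj m n (A : 'M[K]_(m, n)) : 'M[K]_(n, m) := map_mx sg A^T.

Lemma adjE m n (A : 'M_(m, n)) i j : adj A i j = sg (A j i).
Proof. by rewrite !mxE. Qed.
Lemma adjK m n : cancel (@adj m n) (@adj n m).
Proof. by move=> A; apply/matrixP => i j; rewrite !adjE sgK. Qed.
Lemma adjM m n p (A : 'M_(m, n)) (B : 'M_(n, p)) : adj (A *m B) = adj B *m adj A.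
Proof. by rewrite /adj trmx_mul map_mxM. Qed.
Lemma adjD m n (A B : 'M_(m, n)) : adj (A + B) = adj A + adj B.
Proof. by apply/matrixP => i j; rewrite !(adjE, mxE) rmorphD. Qed.
Lemma adjN m n (A : 'M_(m, n)) : adj (- A) = - adj A.
Proof. by apply/matrixP => i j; rewrite !(adjE, mxE) rmorphN. Qed.
Lemma adjB m n (A B : 'M_(m, n)) : adj (A - B) = adj A - adj B.
Proof. by rewrite adjD adjN. Qed.
Lemma adjZ m n c (A : 'M_(m, n)) : adj (c *: A) = sg c *: adj A.
Proof. by apply/matrixP => i j; rewrite !(adjE, mxE) rmorphM. Qed.
Lemma adj0 m n : adj (0 : 'M_(m, n)) = 0.
Proof. by apply/matrixP => i j; rewrite !(adjE, mxE) rmorph0. Qed.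
Lemma adj_scalar n c : adj (c%:M : 'M_n) = (sg c)%:M.
Proof. by rewrite /adj tr_scalar_mx map_scalar_mx. Qed.
Lemma adj1 n : adj (1%:M : 'M_n) = 1%:M.
Proof. by rewrite adj_scalar rmorph1. Qed.
Lemma adj_col m1 m2 n (A : 'M_(m1, n)) (B : 'M_(m2, n)) :
  adj (col_mx A B) = row_mx (adj A) (adj B).
Proof. by rewrite /adj tr_col_mx map_row_mx. Qed.
Lemma adj_row m n1 n2 (A : 'M_(m, n1)) (B : 'M_(m, n2)) :
  adj (row_mx A B) = col_mx (adj A) (adj B).
Proof. by rewrite /adj tr_row_mx map_col_mx. Qed.
Lemma adj_block m1 m2 n1 n2 (A : 'M_(m1, n1)) (B : 'M_(m1, n2))
    (C : 'M_(m2, n1)) (D : 'M_(m2, n2)) :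
  adj (block_mx A B C D) = block_mx (adj A) (adj C) (adj B) (adj D).
Proof. by rewrite /adj tr_block_mx map_block_mx. Qed.
Lemma adj_diag n (d : 'rV_n) : (forall i, d 0 i \is Num.real) ->
  adj (diag_mx d) = diag_mx d.
Proof.
move=> dr; apply/matrixP => i j; rewrite adjE !mxE eq_sym.
by case: eqP => [->|_]; rewrite ?mulr1n ?mulr0n ?rmorph0 // sg_real.
Qed.

Lemma adj_mul_ge0 n (u : 'rV_n) : 0 <= (u *m adj u) 0 0.
Proof. by rewrite mxE sumr_ge0 // => i _; rewrite adjE sgE exprn_ge0. Qed.
Lemma adj_mul_eq0 n (u : 'rV_n) : (u *m adj u) 0 0 = 0 -> u = 0.
Proof.
rewrite mxE => /eqP; rewrite psumr_eq0 => [|i _]; last by rewrite adjE sgE exprn_ge0.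
move=> /allP u0; apply/rowP => i; have := u0 i (mem_index_enum _).
by rewrite adjE sgE expf_eq0 normr_eq0 mxE => /eqP.
Qed.
Lemma adj_mul_gt0 n (u : 'rV_n) : u != 0 -> 0 < (u *m adj u) 0 0.
Proof.
move=> u0; rewrite lt_def adj_mul_ge0 andbT.
by apply: contraNneq u0 => /adj_mul_eq0->.
Qed.

End Adjoint.

Lemma left_kernel_nonzero (K : fieldType) r t (M : 'M[K]_(r, t)) : (t < r)%N ->
  exists2 u : 'rV_r, u != 0 & u *m M = 0.
Proof.
move=> tr; have : kermx M != 0.
  rewrite -mxrank_eq0 mxrank_ker subn_eq0 -ltnNge.
  exact: leq_ltn_trans (rank_leq_col _) tr.
by case/rowV0Pn => u /sub_kermxP uM u0; exists u.
Qed.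

Section Witt.
Variables (K : numFieldType) (sg : {rmorphism K -> K}).
Hypothesis sgE : forall x, x * sg x = `|x| ^+ 2.
Hypothesis sqrtK : forall x : K, 0 <= x -> exists2 y : K, 0 <= y & y ^+ 2 = x.
Variables (r q : nat).
Local Notation n := (r + q)%N.
Local Notation J := (Ipq K r q).
Local Notation adj := (adj sg).

Lemma Ipq_mul : J *m J = 1%:M.
Proof.
rewrite /Ipq mulmx_block !mulmx0 !mul0mx mulmx1 mulmxN mulNmx mulmx1 opprK.
by rewrite !addr0 add0r -scalar_mx_block.
Qed.

Lemma adj_Ipq : adj J = J.
Proof. by rewrite /Ipq adj_block !adj0 adjN !adj1. Qed.

Definition form (u v : 'rV[K]_n) : K := (u *m J *m adj v) 0 0.

Lemma formE u v : u *m J *m adj v = (form u v)%:M.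
Proof. exact: mx11_scalar. Qed.
Lemma formDl u u' v : form (u + u') v = form u v + form u' v.
Proof. by rewrite /form !mulmxDl mxE. Qed.
Lemma formDr u v v' : form u (v + v') = form u v + form u v'.
Proof. by rewrite /form adjD mulmxDr mxE. Qed.
Lemma formZl c u v : form (c *: u) v = c * form u v.
Proof. by rewrite /form -!scalemxAl mxE. Qed.
Lemma formZr c u v : form u (c *: v) = sg c * form u v.
Proof. by rewrite /form adjZ -scalemxAr mxE. Qed.
Lemma formC u v : form v u = sg (form u v).
Proof. by rewrite /form -[RHS](adjE sg) !adjM adjK // adj_Ipq mulmxA. Qed.
Lemma form_real u : form u u \is Num.real.
Proof. by apply: (sg_fixed_real sgE); rewrite -formC. Qed.
Lemma form_split u :
  form u u = (lsubmx u *m adj (lsubmx u)) 0 0 - (rsubmx u *m adj (rsubmx u)) 0 0.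
Proof.
rewrite /form /Ipq -{1 2}[u]hsubmxK adj_row mul_row_block !mulmx0 addr0 add0r.
by rewrite mulmx1 mulmxN mulmx1 mul_row_col mulNmx !mxE.
Qed.

(** Two orthogonal vectors u and w of norms 1 and -1 give the isotropic vectors
    u + w and (u - w)/2.  The predicate P keeps them in a given subspace. *)
Lemma hyperbolic_pair_of_signs (P : 'rV[K]_n -> Prop) x y :
  (forall c u v, P u -> P v -> P (c *: u + v)) -> P x -> P y ->
  0 < form x x -> form y y < 0 ->
  exists e f, [/\ P e, P f, form e e = 0, form f f = 0 & form e f = 1].
Proof.
move=> Plin Px Py x_gt0 y_lt0.
have P0 : P 0 by rewrite -(subrr x) addrC -scaleN1r; apply: Plin.
have PZ c u : P u -> P (c *: u) by move=> Pu; rewrite -[_ *: _]addr0; apply: Plin.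
pose z := (- (form y x / form x x)) *: x + y.
have Pz : P z by apply: Plin.
have zx : form z x = 0.
  by rewrite formDl formZl mulNr divfK ?gt_eqF // addNr.
have z_lt0 : form z z < 0.
  have -> : form z z = form z y by rewrite {2}/z formDr formZr zx mulr0 add0r.
  rewrite formDl formZl (formC y x) mulNr mulrAC sgE.
  rewrite addrC subr_lt0; apply: lt_le_trans y_lt0 _.
  by apply: divr_ge0; [apply/exprn_ge0/normr_ge0|apply: ltW].
have normalise u c : 0 < c * form u u -> c \is Num.real -> P u ->
    exists2 v, P v & exists d, v = d *: u /\ c * form v v = 1.
  move=> cu cr Pu; have [s s0 se] := sqrtK (ltW cu).
  have s1 : s != 0 by apply: contraTneq cu => s1; rewrite -se s1 expr0n ltxx.
  exists (s^-1 *: u); first exact: PZ.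
  exists s^-1; split => //; rewrite formZl formZr sg_real ?realV ?ger0_real //.
  by rewrite !(mulrCA c) -se expr2 mulKf // mulVf.
have [u Pu [cu [uE u1]]] : exists2 u, P u & exists d, u = d *: x /\ 1 * form u u = 1.
  by apply: normalise; rewrite ?mul1r // real1.
have [w Pw [cw [wE w1]]] : exists2 w, P w & exists d, w = d *: z /\ -1 * form w w = 1.
  by apply: normalise; rewrite ?mulN1r ?oppr_gt0 // realN real1.
have wu : form w u = 0 by rewrite wE uE formZl formZr zx !mulr0.
have uw : form u w = 0 by rewrite formC wu rmorph0.
have {}u1 : form u u = 1 by rewrite -[LHS]mul1r.
have {}w1 : form w w = - 1 by apply: oppr_inj; rewrite opprK -mulN1r.
have formN v v' : form v (- v') = - form v v'.
  by rewrite -scaleN1r formZr rmorphN1 mulN1r.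
have formNl v v' : form (- v) v' = - form v v' by rewrite -scaleN1r formZl mulN1r.
exists (u + w), (2^-1 *: (u - w)); split.
- by rewrite -[u]scale1r; apply: Plin.
- by apply: PZ; rewrite addrC -scaleN1r; apply: Plin.
- by rewrite !(formDl, formDr) wu uw u1 w1 addr0 add0r subrr.
- by rewrite formZl formZr !(formDl, formDr, formN, formNl) wu uw u1 w1 opprK
    !oppr0 addr0 add0r subrr !mulr0.
- rewrite formZr !(formDl, formDr, formN) wu uw u1 w1 opprK !oppr0 addr0 add0r.
  by rewrite sg_real ?realV ?realn // mulVf // pnatr_eq0.
Qed.

Variables (As : 'M[K]_n -> Prop) (Pc : 'M[K]_n).
Hypothesis Pcu : Pc \in unitmx.
Hypothesis AsJ : forall A, As A -> A *m J + J *m adj A = 0.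
Hypothesis AsD : forall A, As A ->
  exists2 d : 'rV_n, forall i, d 0 i \is Num.real & Pc *m A = diag_mx d *m Pc.

(** The rows of E and F are hyperbolic pairs of common eigenvectors of As, with
    opposite real weights. *)
Definition hyperbolic_system t (E F : 'M[K]_(t, n)) :=
  [/\ E *m J *m adj E = 0, F *m J *m adj F = 0, E *m J *m adj F = 1%:M
    & forall A, As A -> exists d : 'rV_t, [/\ forall i, d 0 i \is Num.real,
        E *m A = diag_mx d *m E & F *m A = - (diag_mx d *m F)]].

Lemma AsJE A : As A -> A *m J = - (J *m adj A).
Proof. by move=> /AsJ/eqP; rewrite addr_eq0 => /eqP. Qed.

Lemma form_skew A u v : As A -> form (u *m A) v = - form u (v *m A).
Proof.
move=> AA; rewrite /form adjM -[u *m A *m J]mulmxA AsJE // mulmxN mulNmx mxE.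
by rewrite !mulmxA.
Qed.

Section Projection.
Variables (t : nat) (E F : 'M[K]_(t, n)).
Hypothesis EF : hyperbolic_system E F.

(** The orthogonal projection onto the complement of the rows of E and F. *)
Definition perp_proj : 'M[K]_n :=
  1%:M - J *m adj F *m E - J *m adj E *m F.

Lemma gram_FE : F *m J *m adj E = 1%:M.
Proof.
case: EF => _ _ ef _; by move/(congr1 (fun X => adj X)): ef; rewrite !adjM (adjK sgE) adj_Ipq adj1 mulmxA.
Qed.

Lemma mul_perp_proj m (V : 'M[K]_(m, n)) :
  V *m J *m adj E = 0 -> V *m J *m adj F = 0 -> V *m perp_proj = V.
Proof.
move=> vE vF; rewrite !mulmxBr mulmx1 !mulmxA vE vF !mul0mx !subr0 //.
Qed.

Lemma perp_proj_gram :
  perp_proj *m J *m adj E = 0 /\ perp_proj *m J *m adj F = 0.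
Proof.
case: EF => ee ff ef _; have fe := gram_FE.
have mE m (A : 'M_(m, t)) : A *m E *m J *m adj E = 0.
  by rewrite -!mulmxA (mulmxA E) ee mulmx0.
have mF m (A : 'M_(m, t)) : A *m F *m J *m adj F = 0.
  by rewrite -!mulmxA (mulmxA F) ff mulmx0.
have mEF m (A : 'M_(m, t)) : A *m E *m J *m adj F = A.
  by rewrite -!mulmxA (mulmxA E) ef mulmx1.
have mFE m (A : 'M_(m, t)) : A *m F *m J *m adj E = A.
  by rewrite -!mulmxA (mulmxA F) fe mulmx1.
by rewrite /perp_proj !mulmxBl !mul1mx mE mFE mEF mF !subr0 !subrr.
Qed.

Lemma perp_proj_perp m (V : 'M[K]_(m, n)) : V *m perp_proj = V ->
  V *m J *m adj E = 0 /\ V *m J *m adj F = 0.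
Proof.
case: perp_proj_gram => pE pF <-.
by split; rewrite -!mulmxA (mulmxA perp_proj) ?pE ?pF mulmx0.
Qed.

Lemma perp_proj_idem : perp_proj *m perp_proj = perp_proj.
Proof. by case: perp_proj_gram => pE pF; apply: mul_perp_proj. Qed.

Lemma perp_proj_adj : perp_proj *m J = J *m adj perp_proj.
Proof.
rewrite /perp_proj !adjB adj1 !adjM !adj_Ipq !adjK // !mulmxBl !mulmxBr.
by rewrite mul1mx mulmx1 !mulmxA addrAC.
Qed.

Lemma perp_proj_comm A : As A -> A *m perp_proj = perp_proj *m A.
Proof.
move=> AA; case: EF => _ _ _ /(_ A AA)[d [dr EA FA]].
have AF : A *m J *m adj F = J *m adj F *m diag_mx d.
  rewrite AsJE // mulNmx -mulmxA -adjM FA adjN adjM (adj_diag sgE dr).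
  by rewrite mulmxN opprK mulmxA.
have AE : A *m J *m adj E = - (J *m adj E *m diag_mx d).
  by rewrite AsJE // mulNmx -mulmxA -adjM EA adjM (adj_diag sgE dr) mulmxA.
rewrite /perp_proj !mulmxBl !mulmxBr mulmx1 mul1mx !mulmxA AF AE mulNmx.
rewrite -(mulmxA _ E A) EA -(mulmxA _ F A) FA.
by rewrite mulmxN !opprK !mulmxA.
Qed.

End Projection.

(** The projection of v differs from v by a combination of the rows of E, which
    are isotropic and orthogonal to v. *)
Lemma perp_vector t (E F : 'M[K]_(t, n)) v : hyperbolic_system E F ->
  v *m J *m adj E = 0 ->
  exists2 x, x *m perp_proj E F = x & form x x = form v v.
Proof.
move=> EF vE; exists (v *m perp_proj E F).
  by rewrite -mulmxA perp_proj_idem.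
have Ev : E *m J *m adj v = 0.
  by move/(congr1 (fun X => adj X)): vE; rewrite !adjM (adjK sgE) adj_Ipq adj0 mulmxA.
rewrite /form adjM.
have -> : v *m perp_proj E F *m J *m (adj (perp_proj E F) *m adj v) =
    v *m perp_proj E F *m J *m adj v.
  rewrite mulmxA -(mulmxA _ J) -perp_proj_adj mulmxA -(mulmxA v).
  by rewrite perp_proj_idem.
rewrite /perp_proj !mulmxBr mulmx1 !mulmxA vE mul0mx subr0 !mulmxBl.
by rewrite -!(mulmxA _ _ (adj v)) -!(mulmxA _ E) (mulmxA E) Ev mulmx0 subr0.
Qed.

(** As t < r, the positive vectors of the first r coordinates contain a nonzero
    one orthogonal to the t rows of E; likewise for the last q coordinates. *)
Lemma perp_signs t (E F : 'M[K]_(t, n)) : hyperbolic_system E F ->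
  (t < r)%N -> (t < q)%N ->
  exists x y, [/\ x *m perp_proj E F = x, y *m perp_proj E F = y,
    0 < form x x & form y y < 0].
Proof.
move=> EF tr tq.
have [u u0 uE] := left_kernel_nonzero (usubmx (J *m adj E)) tr.
have [w w0 wE] := left_kernel_nonzero (dsubmx (J *m adj E)) tq.
have [|x xP xx] := @perp_vector _ _ _ (row_mx u 0) EF.
  by rewrite -mulmxA -[J *m _]vsubmxK mul_row_col uE mul0mx addr0.
have [|y yP yy] := @perp_vector _ _ _ (row_mx 0 w) EF.
  by rewrite -mulmxA -[J *m _]vsubmxK mul_row_col wE mul0mx addr0.
exists x, y; split=> //.
  by rewrite xx form_split row_mxKl row_mxKr mul0mx [X in _ - X]mxE subr0 adj_mul_gt0.
by rewrite yy form_split row_mxKl row_mxKr mul0mx mxE sub0r oppr_lt0 adj_mul_gt0.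
Qed.

Lemma perp_eigenvectors t (E F : 'M[K]_(t, n)) A : hyperbolic_system E F -> As A ->
  exists2 d : 'rV_n, forall i, d 0 i \is Num.real &
    forall i, row i (Pc *m perp_proj E F) *m A = d 0 i *: row i (Pc *m perp_proj E F).
Proof.
move=> EF AA; have [d dr PA] := AsD AA; exists d => // i.
rewrite -row_mul -mulmxA -perp_proj_comm // mulmxA PA -mulmxA.
by apply/rowP => j; rewrite mul_diag_mx !mxE.
Qed.

Lemma perp_eigenvector_dual t (E F : 'M[K]_(t, n)) i :
  hyperbolic_system E F -> row i (Pc *m perp_proj E F) != 0 ->
  exists j, form (row i (Pc *m perp_proj E F)) (row j (Pc *m perp_proj E F)) != 0.
Proof.
move=> EF; set w := row i _ => w0; apply/existsP; apply: contraNT w0.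
rewrite negb_exists => /forallP w0.
have wP : w *m perp_proj E F = w by rewrite -row_mul -mulmxA perp_proj_idem.
have wJ : w *m J *m adj (Pc *m perp_proj E F) = 0.
  apply/rowP => j; have := w0 j; rewrite negbK /form => /eqP e.
  rewrite [RHS]mxE -[RHS]e !mxE; apply: eq_bigr => k _.
  by congr (_ * _); rewrite !mxE.
have {}wJ : w *m J *m adj Pc = 0.
  rewrite -wP -[w *m _ *m J]mulmxA perp_proj_adj -!mulmxA -adjM.
  by rewrite mulmxA.
have aPcu : adj Pc \in unitmx by rewrite /adj map_unitmx unitmx_tr.
have JJ : w = w *m J *m adj Pc *m invmx (adj Pc) *m J.
  by rewrite mulmxK // -mulmxA Ipq_mul mulmx1.
by rewrite JJ wJ !mul0mx.
Qed.

(** A is skew for the form. *)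
Lemma eigen_orthogonal A u v c c' : As A -> c' \is Num.real ->
  u *m A = c *: u -> v *m A = c' *: v -> c + c' != 0 -> form u v = 0.
Proof.
move=> AA c'r uA vA cc'; have := form_skew u v AA.
rewrite uA vA formZl formZr (sg_real sgE) // => /eqP.
by rewrite -addr_eq0 -mulrDl mulf_eq0 (negPf cc') => /eqP.
Qed.

(** If some common eigenvector of the complement has nonzero weight, it is
    isotropic, and it pairs nontrivially with another common eigenvector, whose
    weight must be opposite.  Otherwise As acts by zero on the complement, and
    any hyperbolic pair in it will do. *)
Lemma hyperbolic_pair t (E F : 'M[K]_(t, n)) : hyperbolic_system E F ->
  (t < r)%N -> (t < q)%N -> exists e f,
    [/\ e *m perp_proj E F = e /\ f *m perp_proj E F = f,
        form e e = 0, form f f = 0, form e f = 1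
      & forall A, As A -> exists c, [/\ c \is Num.real, e *m A = c *: e
          & f *m A = - (c *: f)]].
Proof.
move=> EF tr tq; pose W := Pc *m perp_proj E F.
have WP i : row i W *m perp_proj E F = row i W.
  by rewrite -row_mul -mulmxA perp_proj_idem.
have [[i [A [AA wA]]]|noA] := pselect (exists i A, As A /\ row i W *m A != 0).
  have [d dr Wd] := perp_eigenvectors EF AA.
  have di0 : d 0 i != 0 by apply: contraNneq wA => di; rewrite Wd di scale0r.
  have w0 : row i W != 0 by apply: contraNneq wA => ->; rewrite mul0mx.
  have [j wv] := perp_eigenvector_dual EF w0; rewrite -/W in wv.
  have opp B (dB : 'rV_n) : As B -> (forall k, dB 0 k \is Num.real) ->
      (forall k, row k W *m B = dB 0 k *: row k W) -> dB 0 j = - dB 0 i.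
    move=> BB dBr WB; apply/eqP; rewrite -addr_eq0 addrC; apply: contraNT wv => nz.
    by apply/eqP; apply: (eigen_orthogonal BB _ (WB i) (WB j) nz).
  have ij := opp A d AA dr Wd.
  have twice (x : K) : x != 0 -> x + x != 0.
    by move=> x0; rewrite -mulr2n mulrn_eq0.
  set k := form _ _ in wv.
  exists (row i W), ((sg k)^-1 *: row j W); split.
  - by split; rewrite // -scalemxAl WP.
  - exact: (eigen_orthogonal AA _ (Wd i) (Wd i) (twice _ di0)).
  - rewrite formZl formZr (eigen_orthogonal AA _ (Wd j) (Wd j)) ?mulr0 //.
    by apply: twice; rewrite ij oppr_eq0.
  - by rewrite formZr fmorphV (sgK sgE) mulVf.
  - move=> B BB; have [dB dBr WB] := perp_eigenvectors EF BB.
    exists (dB 0 i); split=> //.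
    by rewrite -scalemxAl WB (opp B dB) // scaleNr scalerN !scalerA mulrC.
have PA A : As A -> perp_proj E F *m A = 0.
  move=> AA; rewrite -[LHS](mulKmx Pcu) (mulmxA Pc) -/W.
  suff -> : W *m A = 0 by rewrite mulmx0.
  apply/row_matrixP => i; rewrite row0 row_mul; apply/eqP; apply: contraT => wA.
  by case: noA; exists i, A.
have [x [y [xP yP x_gt0 y_lt0]]] := perp_signs EF tr tq.
have [|e [f [eP fP ee ff ef]]] :=
    @hyperbolic_pair_of_signs (fun u => u *m perp_proj E F = u) x y _ xP yP x_gt0 y_lt0.
  by move=> c u v uP vP; rewrite mulmxDl -scalemxAl uP vP.
exists e, f; split=> // A AA; exists 0; split; first exact: real0.
  by rewrite -eP -mulmxA PA // mulmx0 scale0r.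
by rewrite -fP -mulmxA PA // mulmx0 scale0r oppr0.
Qed.

Lemma hyperbolic_extend t (E F : 'M[K]_(t, n)) : hyperbolic_system E F ->
  (t < r)%N -> (t < q)%N ->
  exists e f : 'rV_n, hyperbolic_system (col_mx e E) (col_mx f F).
Proof.
move=> EF tr tq; have [e [f [[eP fP] ee ff ef efA]]] := hyperbolic_pair EF tr tq.
have [eE eF] := perp_proj_perp EF eP; have [fE fF] := perp_proj_perp EF fP.
have swap (U : 'M[K]_(t, n)) (v : 'rV_n) :
    v *m J *m adj U = 0 -> U *m J *m adj v = 0.
  by move/(congr1 (fun X => adj X)); rewrite !adjM (adjK sgE) adj_Ipq adj0 mulmxA.
case: (EF) => EE FF EF1 EFA; exists e, f.
split.
- by rewrite adj_col [X in X *m _]mul_col_mx mul_col_row formE ee eE EE (swap _ e) // raddf0 block_mx0.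
- by rewrite adj_col [X in X *m _]mul_col_mx mul_col_row formE ff fF FF (swap _ f) // raddf0 block_mx0.
- by rewrite adj_col [X in X *m _]mul_col_mx mul_col_row formE ef eF EF1 (swap _ f) // -scalar_mx_block.
- move=> A AA; have [c [cr eA fA]] := efA A AA; have [d [dr EA FA]] := EFA A AA.
  exists (row_mx c%:M d); split.
  + move=> i; rewrite mxE; case: split => k; rewrite ?dr //.
    by rewrite mxE (ord1 k) eqxx mulr1n.
  + rewrite diag_mx_row mul_col_mx mul_block_col !mul0mx addr0 add0r eA EA.
    by congr col_mx; apply/rowP => k; rewrite mul_diag_mx !mxE eqxx mulr1n.
  + rewrite diag_mx_row mul_col_mx mul_block_col !mul0mx addr0 add0r fA FA.
    rewrite opp_col_mx; congr col_mx; congr (- _).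
    by apply/rowP => k; rewrite mul_diag_mx !mxE eqxx mulr1n.
Qed.

Lemma hyperbolic_system_exists t : (t <= r)%N -> (t <= q)%N ->
  exists E F : 'M[K]_(t, n), hyperbolic_system E F.
Proof.
elim: t => [|t IH] tr tq.
  exists 0, 0; split; rewrite ?mul0mx ?flatmx0 //; try exact/matrixP => -[].
  by move=> A AA; exists 0; split; [move=> [] | | ]; rewrite ?flatmx0 //; exact/matrixP => -[].
have [E [F EF]] := IH (ltnW tr) (ltnW tq).
have [e [f ef]] := hyperbolic_extend EF tr tq.
by exists (col_mx e E), (col_mx f F).
Qed.

(** A vector x of nonnegative norm orthogonal to all r pairs would span with the
    e_i + f_i a nonnegative subspace of dimension r + 1.  Some nonzero vector of
    it has its first r coordinates zero, hence negative norm. *)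
Lemma perp_negative (E F : 'M[K]_(r, n)) x : hyperbolic_system E F ->
  x *m J *m adj E = 0 -> x *m J *m adj F = 0 -> x != 0 -> form x x < 0.
Proof.
move=> EF xE xF x0; case: (EF) => EE FF EF1 _; have FE := gram_FE EF.
rewrite real_ltNge ?form_real ?real0 //; apply/negP => xx.
have [c c0 cM] := left_kernel_nonzero (lsubmx (col_mx x (E + F))) (ltnSn r).
(* v = c0 x + sum of the c_i (e_i + f_i), and its first r coordinates vanish *)
pose v := c *m col_mx x (E + F).
have lv : lsubmx v = 0 by rewrite /v -cM -[col_mx x _ in LHS]hsubmxK mul_mx_row row_mxKl.
have v_le0 : form v v <= 0.
  by rewrite form_split lv mul0mx [X in X - _]mxE sub0r oppr_le0 adj_mul_ge0.
set c1 := lsubmx c : 'rV_1; set c2 := rsubmx c : 'rV_r.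
have vE : v = c1 *m x + c2 *m (E + F) by rewrite /v -[c]hsubmxK mul_row_col.
have swap (U : 'M[K]_(r, n)) : x *m J *m adj U = 0 -> U *m J *m adj x = 0.
  by move/(congr1 (fun X => adj X)); rewrite !adjM (adjK sgE) adj_Ipq adj0 mulmxA.
have vv : form v v = (c1 *m adj c1) 0 0 * form x x + (c2 *m adj c2) 0 0 *+ 2.
  rewrite [in LHS]/form vE !adjD !adjM !adjD.
  have -> : (c1 *m x + c2 *m (E + F)) *m J *m
      (adj x *m adj c1 + (adj E + adj F) *m adj c2) =
    c1 *m (x *m J *m adj x) *m adj c1 + c1 *m (x *m J *m (adj E + adj F)) *m adj c2
    + (c2 *m ((E + F) *m J *m adj x) *m adj c1
       + c2 *m ((E + F) *m J *m (adj E + adj F)) *m adj c2).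
    by move: (E + F) (adj E + adj F) => M M'; rewrite !mulmxDl !mulmxDr !mulmxA.
  rewrite [x *m J *m (_ + _)]mulmxDr xE xF addr0 mulmx0 mul0mx addr0.
  have -> : (E + F) *m J *m adj x = 0 by rewrite !mulmxDl (swap E) // (swap F) // addr0.
  rewrite mulmx0 mul0mx add0r.
  have -> : (E + F) *m J *m (adj E + adj F) = 1%:M + 1%:M.
    by rewrite !mulmxDl !mulmxDr EE FF EF1 FE addr0 add0r.
  rewrite mulmxDr !mulmx1 mulmxDl.
  rewrite formE mul_mx_scalar -scalemxAl.
  by rewrite !mxE -mulr2n mulrC.
have a1 := adj_mul_ge0 sgE c1; have a2 := adj_mul_ge0 sgE c2.
have vv0 : form v v = 0.
  by apply/eqP; rewrite eq_le v_le0 vv addr_ge0 ?mulr_ge0 ?mulrn_wge0.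
have c20 : c2 = 0.
  apply: (adj_mul_eq0 sgE); move/eqP: vv0; rewrite vv paddr_eq0 ?mulr_ge0 ?mulrn_wge0 //.
  by rewrite mulrn_eq0 => /andP[_ /eqP].
have v0 : v = 0.
  rewrite -[v]hsubmxK lv; suff -> : rsubmx v = 0 by rewrite row_mx0.
  apply: (adj_mul_eq0 sgE); move/eqP: vv0.
  by rewrite form_split lv mul0mx [X in X - _]mxE sub0r oppr_eq0 => /eqP.
have c10 : c1 != 0.
  by apply: contraNneq c0 => c10; rewrite -[c]hsubmxK -/c1 -/c2 c10 c20 row_mx0.
have : c1 *m x = 0 by rewrite -v0 vE c20 mul0mx addr0.
rewrite [c1]mx11_scalar mul_scalar_mx => /eqP; rewrite scaler_eq0 (negPf x0) orbF.
by move/eqP => e; rewrite [c1]mx11_scalar e raddf0 eqxx in c10.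
Qed.

(** Gram-Schmidt orthonormalization inside the complement of E and F. *)
Lemma negative_orthonormal (E F : 'M[K]_(r, n)) t : hyperbolic_system E F ->
  (r + t <= q)%N -> exists W : 'M[K]_(t, n),
  [/\ W *m J *m adj W = - 1%:M, W *m J *m adj E = 0 & W *m J *m adj F = 0].
Proof.
move=> EF; elim: t => [|t IH] tq.
  by exists 0; split; rewrite ?mul0mx //; apply/matrixP => -[].
have [|W [WW WE WF]] := IH; first by rewrite (leq_trans _ tq) // leq_add2l.
have [|x x0 xM] := left_kernel_nonzero (J *m row_mx (adj E) (row_mx (adj F) (adj W))).
  by rewrite ltn_add2l -addnS.
move: xM; rewrite mulmxA !mul_mx_row -row_mx0 => /eq_row_mx[xE].
rewrite -row_mx0 => /eq_row_mx[xF xW].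
have x_lt0 := perp_negative EF xE xF x0.
have [s s0 se] : exists2 s : K, 0 <= s & s ^+ 2 = - form x x.
  by apply: sqrtK; rewrite oppr_ge0 ltW.
have s1 : s != 0.
  apply: contraTneq x_lt0 => s1; rewrite -[form x x]opprK -se s1 expr0n oppr0.
  by rewrite ltxx.
pose w := s^-1 *: x.
have ww : form w w = - 1.
  rewrite formZl formZr (sg_real sgE) ?realV ?ger0_real //.
  by rewrite -[form x x]opprK -se expr2 !mulrN mulKf // mulVf.
have wW : w *m J *m adj W = 0 by rewrite -!scalemxAl xW scaler0.
have Ww : W *m J *m adj w = 0.
  move/(congr1 (fun X => adj X)): wW.
  by rewrite !adjM (adjK sgE) adj_Ipq adj0 mulmxA.
suff [V VP] : exists V : 'M[K]_(1 + t, n),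
    [/\ V *m J *m adj V = - 1%:M, V *m J *m adj E = 0 & V *m J *m adj F = 0].
  by exists V.
exists (col_mx w W); split.
- rewrite adj_col [X in X *m _]mul_col_mx mul_col_row formE ww wW Ww WW.
  by rewrite [in RHS]scalar_mx_block opp_block_mx !oppr0 (raddfN (@scalar_mx K 1)).
- by rewrite !mul_col_mx WE -!scalemxAl xE scaler0 col_mx0.
- by rewrite !mul_col_mx WF -!scalemxAl xF scaler0 col_mx0.
Qed.

(** The complement is definite, whereas an eigenvector of nonzero weight is
    isotropic: only the weight 0 occurs. *)
Lemma perp_killed (E F : 'M[K]_(r, n)) m (W : 'M[K]_(m, n)) A :
  hyperbolic_system E F -> As A ->
  W *m J *m adj E = 0 -> W *m J *m adj F = 0 -> W *m A = 0.
Proof.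
move=> EF AA WE WF; rewrite -(mul_perp_proj WE WF) -mulmxA.
suff -> : perp_proj E F *m A = 0 by rewrite mulmx0.
rewrite -[LHS](mulKmx Pcu) (mulmxA Pc).
suff -> : Pc *m perp_proj E F *m A = 0 by rewrite mulmx0.
have [d dr Wd] := perp_eigenvectors EF AA.
apply/row_matrixP => i; rewrite row0 row_mul Wd.
have [->|di] := eqVneq (d 0 i) 0; first by rewrite scale0r.
have [->|w0] := eqVneq (row i (Pc *m perp_proj E F)) 0; first by rewrite scaler0.
have [wE wF] : row i (Pc *m perp_proj E F) *m J *m adj E = 0 /\
    row i (Pc *m perp_proj E F) *m J *m adj F = 0.
  by apply: perp_proj_perp => //; rewrite -row_mul -mulmxA perp_proj_idem.
have := perp_negative EF wE wF w0.
rewrite (eigen_orthogonal AA (dr i) (Wd i) (Wd i)) ?ltxx //.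
by rewrite -mulr2n mulrn_eq0.
Qed.

End Witt.

Section WittBasis.
Variables (K : numFieldType) (sg : {rmorphism K -> K}).
Hypothesis sgE : forall x, x * sg x = `|x| ^+ 2.
Hypothesis sqrtK : forall x : K, 0 <= x -> exists2 y : K, 0 <= y & y ^+ 2 = x.
Variables (r k : nat).
Local Notation n := (r + (r + k))%N.
Local Notation J := (Ipq K r (r + k)).
Local Notation adj := (adj sg).

(** The Gram matrix of a basis e_i, f_i, w_l. *)
Definition witt_gram : 'M[K]_n :=
  block_mx 0 (row_mx 1%:M 0) (col_mx 1%:M 0) (block_mx 0 0 0 (- 1%:M)).

Lemma witt_gram_sq : witt_gram *m witt_gram = 1%:M.
Proof.
rewrite /witt_gram mulmx_block mul_row_block mul_block_col mulmx_block.
rewrite mul_col_row mul_row_col !(mulmx0, mul0mx, mulmx1, mul1mx, mulmxN, mulNmx).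
rewrite !(addr0, add0r, opprK, oppr0, row_mx0, col_mx0, add_block_mx).
by rewrite -!scalar_mx_block.
Qed.

Definition torus_row (t : 'rV[K]_r) : 'rV[K]_n := row_mx t (row_mx (- t) 0).

(** Pc diagonalizes the commuting family As.  Hyperbolic pairs of common
    eigenvectors are split off until r of them are found; on the remaining
    negative definite space As acts by zero. *)
Theorem witt_basis (As : 'M[K]_n -> Prop) (Pc : 'M[K]_n) : Pc \in unitmx ->
  (forall A, As A -> A *m J + J *m adj A = 0) ->
  (forall A, As A -> exists2 d : 'rV_n, forall i, d 0 i \is Num.real &
     Pc *m A = diag_mx d *m Pc) ->
  exists2 P : 'M[K]_n, P *m J *m adj P = witt_gram &
    forall A, As A -> exists2 t : 'rV_r, forall i, t 0 i \is Num.real &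
      P *m A = diag_mx (torus_row t) *m P.
Proof.
move=> Pcu AsJ AsD.
have [E [F EF]] := hyperbolic_system_exists sgE sqrtK Pcu AsJ AsD (leqnn r) (leq_addr k r).
have [W [WW WE WF]] := negative_orthonormal sgE sqrtK EF (leqnn (r + k)).
have swap (U : 'M[K]_(r, n)) : W *m J *m adj U = 0 -> U *m J *m adj W = 0.
  by move/(congr1 (fun X => adj X)); rewrite !adjM (adjK sgE) adj_Ipq adj0 mulmxA.
case: (EF) => EE FF EF1 EFA; have FE := gram_FE sgE EF.
exists (col_mx E (col_mx F W)).
  rewrite !adj_col (mul_col_mx E) (mul_col_mx F) mul_col_row.
  by rewrite mul_mx_row mul_col_mx mul_col_row EE EF1 FE FF WE WF WW !swap.
move=> A AA; have [t [tr EA FA]] := EFA A AA; exists t => //.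
rewrite /torus_row !mul_col_mx EA FA (perp_killed sgE Pcu AsJ AsD EF AA WE WF).
rewrite !diag_mx_row mul_block_col !mul0mx addr0 add0r mul_block_col !mul0mx.
by rewrite addr0 add0r raddfN mulNmx raddf0 mul0mx.
Qed.

End WittBasis.

(** * Parabolic block matrices *)

Section ParabolicBlocks.
Variables (K : numFieldType) (sg : {rmorphism K -> K}).
Hypothesis sgE : forall x, x * sg x = `|x| ^+ 2.
Variables (r k : nat).
Local Notation n := (r + (r + k))%N.
Local Notation J := (Ipq K r (r + k)).
Local Notation adj := (adj sg).
Local Notation S := (@witt_gram K r k).
Implicit Types (A B : 'M[K]_r) (C : 'M[K]_(r, k)).

(** The last two rows of blocks are those that make the matrix skew for
    [witt_gram] when B is skew-Hermitian. *)
Definition parabolic_mx A B C : 'M[K]_n :=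
  block_mx A (row_mx B C) 0 (block_mx (- adj A) 0 (adj C) 0).

Lemma parabolic_mxE A B C : parabolic_mx A B C =
  block_mx A (row_mx B C) (col_mx 0 0) (block_mx (- adj A) 0 (adj C) 0).
Proof. by rewrite col_mx0. Qed.

Lemma parabolic_mxM A B C A' B' C' :
  parabolic_mx A B C *m parabolic_mx A' B' C' =
  block_mx (A *m A') (row_mx (A *m B' - B *m adj A' + C *m adj C') (A *m C'))
    0 (block_mx (adj A *m adj A') 0 (- (adj C *m adj A')) 0).
Proof.
rewrite /parabolic_mx !mulmx_block mul_mx_row mul_row_block.
rewrite !(mulmx0, mul0mx, mulmxN, mulNmx, opprK, addr0, add0r, oppr0) add_row_mx.
by rewrite addr0 addrA.
Qed.

Lemma parabolic_mx_lie A B C A' B' C' :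
  mxlie (parabolic_mx A B C) (parabolic_mx A' B' C') =
  parabolic_mx (A *m A' - A' *m A)
    (A *m B' + B' *m adj A - (A' *m B + B *m adj A')
      + (C *m adj C' - C' *m adj C))
    (A *m C' - A' *m C).
Proof.
rewrite /mxlie !parabolic_mxM /parabolic_mx opp_block_mx add_block_mx.
rewrite opp_row_mx add_row_mx opp_block_mx add_block_mx !oppr0 !addr0.
congr (block_mx _ (row_mx _ _) _ (block_mx _ _ _ _)).
- rewrite opprD addrACA; congr (_ + _).
  by rewrite opprB addrACA; congr (_ + _); rewrite -opprD addrC.
- by rewrite adjB !adjM opprB.
- by rewrite adjB !adjM opprK addrC.
Qed.

Lemma parabolic_mxD A B C A' B' C' :
  parabolic_mx (A + A') (B + B') (C + C') = parabolic_mx A B C + parabolic_mx A' B' C'.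
Proof.
by rewrite /parabolic_mx add_block_mx add_row_mx add_block_mx !adjD opprD !addr0.
Qed.

Lemma parabolic_mxZ c A B C : c \is Num.real ->
  parabolic_mx (c *: A) (c *: B) (c *: C) = c *: parabolic_mx A B C.
Proof.
move=> cr; rewrite /parabolic_mx scale_block_mx scale_row_mx scale_block_mx.
by rewrite !adjZ (sg_real sgE cr) scalerN !scaler0.
Qed.

Lemma parabolic_mx0 : parabolic_mx 0 0 0 = 0.
Proof. by rewrite /parabolic_mx !adj0 oppr0 !(row_mx0, block_mx0). Qed.

Lemma parabolic_mx_inj A B C A' B' C' :
  parabolic_mx A B C = parabolic_mx A' B' C' -> [/\ A = A', B = B' & C = C'].
Proof. by case/eq_block_mx => -> /eq_row_mx[-> ->]. Qed.

Lemma parabolic_torus (t : 'rV[K]_r) : (forall i, t 0 i \is Num.real) ->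
  diag_mx (torus_row k t) = parabolic_mx (diag_mx t) 0 0.
Proof.
move=> tr; rewrite /parabolic_mx /torus_row !diag_mx_row raddfN raddf0 adj0.
by rewrite (adj_diag sgE tr) row_mx0.
Qed.

Lemma gram_block_mul (A B D E : 'M[K]_r) (C F : 'M[K]_(r, k)) (G H : 'M[K]_(k, r)) N :
  block_mx A (row_mx B C) (col_mx D G) (block_mx E F H N) *m S =
  block_mx B (row_mx A (- C)) (col_mx E H) (block_mx D (- F) G (- N)).
Proof.
rewrite /witt_gram mulmx_block !mulmx0 !add0r.
rewrite mul_row_col mul_block_col mul_mx_row mul_row_block mul_col_row mulmx_block.
rewrite !(mulmx0, mulmx1, mulmxN, mul_mx_row) !(addr0, add0r) add_row_mx add_block_mx.
by rewrite !(addr0, add0r).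
Qed.

Lemma mul_gram_block (A B D E : 'M[K]_r) (C F : 'M[K]_(r, k)) (G H : 'M[K]_(k, r)) N :
  S *m block_mx A (row_mx B C) (col_mx D G) (block_mx E F H N) =
  block_mx D (row_mx E F) (col_mx A (- G)) (block_mx B C (- H) (- N)).
Proof.
rewrite /witt_gram mulmx_block !mul0mx !add0r.
rewrite mul_row_col mul_block_col mul_row_block mul_col_row mulmx_block mul_col_mx.
rewrite !(mul0mx, mul1mx, mulNmx) !(addr0, add0r) add_col_mx add_block_mx.
by rewrite !(addr0, add0r).
Qed.

(** The product with [witt_gram] exchanges the first two block columns. *)
Lemma gram_skew_blocks (A B D E : 'M[K]_r) (C F : 'M[K]_(r, k)) (G H : 'M[K]_(k, r)) N Y :
  Y = block_mx A (row_mx B C) (col_mx D G) (block_mx E F H N) ->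
  Y *m S + S *m adj Y = 0 <->
  [/\ B + adj B = 0, E = - adj A, H = adj C, D + adj D = 0 & F = adj G /\ N + adj N = 0].
Proof.
move=> ->; rewrite adj_block adj_row adj_col adj_block mul_gram_block gram_block_mul.
rewrite add_block_mx add_row_mx add_col_mx add_block_mx.
split.
  rewrite -block_mx0; case/eq_block_mx => eB.
  rewrite -row_mx0 => /eq_row_mx[_ eC].
  rewrite -col_mx0 => /eq_col_mx[eE eH].
  rewrite -block_mx0 => /eq_block_mx[eD eF _ eN].
  split=> //.
  - by apply/eqP; rewrite -addr_eq0 eE.
  - by apply/eqP; rewrite -subr_eq0 eH.
  - split; first by apply/eqP; rewrite eq_sym -subr_eq0 addrC eF.
    by apply/oppr_inj; rewrite opprD oppr0.
case=> eB -> -> eD [-> eN]; rewrite eB eD adjN !(adjK sgE) !subrr !addNr -opprD eN.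
by rewrite oppr0 row_mx0 col_mx0 !block_mx0.
Qed.

End ParabolicBlocks.

(** * Linear algebra over predicates *)

(** A subspace of maximal dimension among those contained in Q. *)
Lemma vspace_of_predicate (F : fieldType) (V : vectType F) (Q : V -> Prop) :
  Q 0 -> (forall c x y, Q x -> Q y -> Q (c *: x + y)) ->
  exists U : {vspace V}, forall x, x \in U <-> Q x.
Proof.
move=> Q0 Qlin.
pose ok d := `[< exists2 U : {vspace V}, \dim U = d & forall x, x \in U -> Q x >].
have ok0 : exists d, ok d.
  by exists 0%N; apply/asboolP; exists 0%VS; rewrite ?dimv0 // => x; rewrite memv0 => /eqP->.
have okle d : ok d -> (d <= \dim {:V})%N.
  by move/asboolP => [U <- _]; apply/dimvS/subvf.
case: (ex_maxnP ok0 okle) => d /asboolP[U dU UQ] dmax.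
exists U => x; split=> [/UQ//|Qx].
have le : (\dim (U + <[x]>) <= \dim U)%N.
  rewrite dU; apply/dmax/asboolP; exists (U + <[x]>)%VS => //.
  move=> _ /memv_addP[u uU [_ /vlineP[c ->] ->]].
  by rewrite addrC; apply: Qlin => //; apply: UQ.
have /eqP-> : U == (U + <[x]>)%VS by rewrite eqEdim addvSl.
by rewrite (subvP (addvSr _ _)) ?memv_line.
Qed.

Lemma hom_of_linear (F : fieldType) (U V : vectType F) (f : U -> V) :
  linear f -> exists h : 'Hom(U, V), forall x, h x = f x.
Proof.
move=> fl; pose m := GRing.isLinear.Build F U V _ f fl.
pose f' : {linear U -> V} := HB.pack f m.
by exists (linfun f') => x; rewrite lfunE.
Qed.

(** An operator killed by a product of distinct linear factors is
    diagonalizable.  Inductively, (ad z - c) x is a sum of eigenvectors y_i for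
    eigenvalues d_i other than c, and x minus the sum of the y_i / (d_i - c) is
    an eigenvector for c. *)
Lemma ad_annihilated_semisimple (R : realType) (L : lieAlgType R) (g : {vspace L})
    z (s : seq R) : is_subalgebra g -> z \in g -> uniq s ->
  (forall x, x \in g -> foldl (fun v c => lie z v - c *: v) x s = 0) ->
  ad_semisimple g z.
Proof.
move=> gS gz us kill x gx.
suff [m [E [c [-> Ec]]]] : exists m (E : 'I_m -> L) (c : 'I_m -> R), x = \sum_i E i /\
    forall i, [/\ E i \in g, lie z (E i) = c i *: E i & c i \in s].
  by exists m, E, c; split=> // i; have [] := Ec i.
elim: s us x gx {kill}(kill x gx) => [_ x _ /= -> | c s IH /= /andP[cs us] x gx kx].
  exists 0, (fun=> 0), (fun=> 0); rewrite big_ord0; split=> // [] [] //.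
have gy : lie z x - c *: x \in g by rewrite rpredB ?gS ?memvZ.
have [m [E [d [yE Ed]]]] := IH us _ gy kx.
pose E0 := x - \sum_i (d i - c)^-1 *: E i.
have dc i : d i - c != 0.
  by rewrite subr_eq0; have [_ _ ds] := Ed i; apply: contraNneq cs => <-.
have gE0 : E0 \in g.
  by rewrite rpredB // rpred_sum // => i _; apply: memvZ; case: (Ed i).
have zE0 : lie z E0 = c *: E0.
  have zT : lie z (\sum_i (d i - c)^-1 *: E i) - c *: (\sum_i (d i - c)^-1 *: E i) =
      \sum_i E i.
    rewrite lie_sumr scaler_sumr -sumrB; apply: eq_bigr => i _.
    have [_ zEi _] := Ed i; rewrite lieZr zEi scalerA mulrC scalerA.
    by rewrite -scalerBl -mulrBl mulfV // scale1r.
  apply/eqP; rewrite -subr_eq0 lieBr scalerBr opprD addrACA -opprD zT -yE.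
  by rewrite subrr.
exists m.+1, (fun i => oapp (fun j => (d j - c)^-1 *: E j) E0 (unlift ord0 i)),
  (fun i => oapp d c (unlift ord0 i)); split.
  rewrite big_ord_recl unlift_none /= /E0; under eq_bigr => i _ do rewrite liftK /=.
  by rewrite subrK.
move=> i; case: unliftP => [j|] _ /=; last by rewrite mem_head.
have [gE zE ds] := Ed j; rewrite lieZr zE !scalerA mulrC inE ds orbT.
by split=> //; apply: memvZ.
Qed.

(** * Iwasawa components of indefinite unitary Lie algebras *)

(** The set-up covers so(r, r + k) and su(r, r + k): [phi] identifies the real Lie
    algebra L with the matrices over K, and [iota] embeds the real scalars. *)
Section UnitaryIwasawa.
Variables (R : realType) (K : numFieldType).
Variables (sg : {rmorphism K -> K}) (iota : {rmorphism R -> K}).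
Hypothesis sgE : forall x, x * sg x = `|x| ^+ 2.
Hypothesis sqrtK : forall x : K, 0 <= x -> exists2 y : K, 0 <= y & y ^+ 2 = x.
Hypothesis iota_real : forall c, iota c \is Num.real.
Hypothesis real_iota : forall y, y \is Num.real -> exists c, y = iota c.
Variables (r k : nat).
Local Notation n := (r + (r + k))%N.
Local Notation J := (Ipq K r (r + k)).
Local Notation S := (@witt_gram K r k).
Local Notation adj := (adj sg).
Variables (L : lieAlgType R) (g : {vspace L}).
Variables (phi : L -> 'M[K]_n) (psi : 'M[K]_n -> L).
Hypothesis phi_linear : forall c x y, phi (c *: x + y) = iota c *: phi x + phi y.
Hypothesis phiK : cancel phi psi.
Hypothesis psiK : cancel psi phi.
Hypothesis phi_lie : forall x y, phi (lie x y) = mxlie (phi x) (phi y).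
Hypothesis gP : forall x,
  x \in g <-> phi x *m J + J *m adj (phi x) = 0 /\ \tr (phi x) = 0.
Hypothesis ad_standard : forall h, h \in g -> ad_semisimple g h ->
  diagonalizable (phi h) /\ forall c, eigenvalue (phi h) c -> c \is Num.real.

Lemma phiD x y : phi (x + y) = phi x + phi y.
Proof. by rewrite -[x]scale1r phi_linear rmorph1 !scale1r. Qed.
Lemma phi0 : phi 0 = 0.
Proof. by apply: (addrI (phi 0)); rewrite -phiD !addr0. Qed.
Lemma phiZ c x : phi (c *: x) = iota c *: phi x.
Proof. by rewrite -[c *: x]addr0 phi_linear phi0 addr0. Qed.
Lemma phiB x y : phi (x - y) = phi x - phi y.
Proof. by rewrite phiD -scaleN1r phiZ rmorphN1 scaleN1r. Qed.
Lemma phi_sum (I : finType) (f : I -> L) : phi (\sum_i f i) = \sum_i phi (f i).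
Proof. exact: (big_morph phi phiD phi0). Qed.
Lemma phi_inj : injective phi.
Proof. exact: can_inj phiK. Qed.

Lemma unitary_subalgebra : is_subalgebra g.
Proof.
move=> x y /gP[xJ _] /gP[yJ _]; apply/gP; rewrite phi_lie /mxlie.
move: xJ yJ => /eqP; rewrite addr_eq0 => /eqP xJ /eqP; rewrite addr_eq0 => /eqP yJ.
split; last by rewrite raddfB /= mxtrace_mulC subrr.
rewrite mulmxBl adjB !adjM mulmxBr -!mulmxA yJ xJ !mulmxN !mulmxA xJ yJ !mulNmx !opprK.
by rewrite addrC subrKA subrr.
Qed.

Section Coordinates.
Variable P : 'M[K]_n.
Hypothesis PJ : P *m J *m adj P = S.

Lemma witt_unit : P \in unitmx.
Proof.
have : P *m (J *m adj P *m S) = 1%:M by rewrite !mulmxA PJ witt_gram_sq.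
by case/mulmx1_unit.
Qed.

Lemma skew_coordinates X Y : P *m X = Y *m P ->
  X *m J + J *m adj X = 0 <-> Y *m S + S *m adj Y = 0.
Proof.
move=> PX.
have e : P *m (X *m J + J *m adj X) *m adj P = Y *m S + S *m adj Y.
  rewrite mulmxDr mulmxDl !mulmxA PX -[X in _ + X]mulmxA -adjM PX adjM -PJ.
  by rewrite !mulmxA.
split=> [e0|e0]; first by rewrite -e e0 mulmx0 mul0mx.
have Pu := witt_unit; have aPu : adj P \in unitmx by rewrite /adj map_unitmx unitmx_tr.
rewrite -[LHS](mulKmx Pu) -[P *m _](mulmxK aPu) e e0.
by rewrite mul0mx mulmx0.
Qed.

Lemma lie_coordinates x y X Y : P *m phi x = X *m P -> P *m phi y = Y *m P ->
  P *m phi (lie x y) = mxlie X Y *m P.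
Proof.
move=> px py; rewrite phi_lie /mxlie mulmxBr mulmxBl !mulmxA px py.
by rewrite -!mulmxA px py.
Qed.

Definition from_coordinates Y : L := psi (invmx P *m Y *m P).

Lemma from_coordinatesK Y : P *m phi (from_coordinates Y) = Y *m P.
Proof. by rewrite psiK !mulmxA mulmxV ?witt_unit // mul1mx. Qed.

Lemma coordinates_inj x y Y : P *m phi x = Y *m P -> P *m phi y = Y *m P -> x = y.
Proof.
move=> px py; apply: phi_inj.
by rewrite -[LHS](mulKmx witt_unit) px -py mulKmx ?witt_unit.
Qed.

Lemma trace_coordinates X Y : P *m X = Y *m P -> \tr X = \tr Y.
Proof.
move=> PX; rewrite -[X](mulKmx witt_unit) PX mulmxA mxtrace_mulC mulmxA.
by rewrite mulmxV ?witt_unit // mul1mx.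
Qed.

Lemma coordinates_mem x A B C : P *m phi x = parabolic_mx sg A B C *m P ->
  B + adj B = 0 -> (forall i, A i i \is Num.real) -> x \in g.
Proof.
move=> Px Bs Ar; apply/gP; split.
  apply/(skew_coordinates Px)/(gram_skew_blocks sgE (parabolic_mxE _ _ _ _)).
  by rewrite !adj0 !addr0 Bs.
rewrite (trace_coordinates Px) /parabolic_mx mxtrace_block mxtrace_block mxtrace0 addr0.
rewrite raddfN; apply/eqP; rewrite subr_eq0; apply/eqP/eq_bigr => i _.
by rewrite adjE (sg_real sgE).
Qed.

Lemma torus_bracket (w : 'I_n -> R) z v Y c :
  P *m phi z = diag_mx (\row_i iota (w i)) *m P -> P *m phi v = Y *m P ->
  P *m phi (lie z v - c *: v) =
    (\matrix_(i, j) (iota (w i - w j - c) * Y i j)) *m P.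
Proof.
move=> Pz Pv; rewrite phiB phiZ mulmxBr -scalemxAr (lie_coordinates Pz Pv) Pv.
rewrite scalemxAl -mulmxBl; congr (_ *m P); apply/matrixP => i j.
rewrite /mxlie mul_diag_mx mul_mx_diag !mxE !rmorphB !mulrBl.
by rewrite [Y i j * _]mulrC.
Qed.

(** In coordinates ad z multiplies the entry (i, j) by w_i - w_j. *)
Lemma torus_ad_semisimple (w : 'I_n -> R) z : z \in g ->
  P *m phi z = diag_mx (\row_i iota (w i)) *m P -> ad_semisimple g z.
Proof.
move=> gz Pz.
pose s := undup [seq w i - w j | i <- enum 'I_n, j <- enum 'I_n].
apply: (ad_annihilated_semisimple (s := s)) => //; rewrite ?undup_uniq //.
  exact: unitary_subalgebra.
have key (v : L) (t : seq R) (Y : 'M[K]_n) : P *m phi v = Y *m P ->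
    P *m phi (foldl (fun v c => lie z v - c *: v) v t) =
    (\matrix_(i, j) ((\prod_(c <- t) iota (w i - w j - c)) * Y i j)) *m P.
  elim: t v Y => [|c t IH] v Y Pv /=.
    rewrite Pv; congr (_ *m P); apply/matrixP => i j.
    by rewrite mxE big_nil mul1r.
  rewrite (IH _ _ (torus_bracket c Pz Pv)); congr (_ *m P); apply/matrixP => i j.
  by rewrite !mxE big_cons mulrA [X in X * _]mulrC.
move=> x gx; apply: (@coordinates_inj _ _ 0); last by rewrite phi0 mulmx0 mul0mx.
have Px : P *m phi x = P *m phi x *m invmx P *m P by rewrite mulmxKV ?witt_unit.
rewrite (key _ _ _ Px); congr (_ *m P); apply/matrixP => i j; rewrite !mxE.
have ij : w i - w j \in s.
  by rewrite mem_undup; apply/allpairsP; exists (i, j); rewrite !mem_enum.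
by rewrite (perm_big _ (perm_to_rem ij)) big_cons subrr (rmorph0 iota) /= !mul0r.
Qed.

End Coordinates.

Section Iwasawa.
Variables (theta : 'End(L)) (a nn : {vspace L}) (pos : dual a -> Prop).
Hypothesis thetaC : is_cartan_involution g theta.
Hypothesis aM : is_maximal_abelian_in (g :&: passmx.leigenspace theta (-1)) a.
Hypothesis posP : is_positivity pos.
Hypothesis nnP : is_positive_nilpotent g pos nn.

Lemma iwasawa_a_mem h : h \in a -> h \in g /\ theta h = - h.
Proof. by case: aM => ap _ _ /(subvP ap)/(cartan_pP erefl). Qed.

Lemma iwasawa_a_diagonal : exists2 Pc, Pc \in unitmx &
  forall h, h \in a -> exists2 d : 'rV_n, forall i, d 0 i \is Num.real &
    Pc *m phi h = diag_mx d *m Pc.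
Proof.
have std h : h \in a ->
    diagonalizable (phi h) /\ forall c, eigenvalue (phi h) c -> c \is Num.real.
  move=> /iwasawa_a_mem[gh thh]; apply: ad_standard => //.
  exact: (ad_semisimple_p unitary_subalgebra thetaC).
have [Pc Pcu /allP Pcd] : codiagonalizable [seq phi h | h <- vbasis a].
  apply/codiagonalizableP; split.
    move=> _ _ /mapP[x /vbasis_mem ax ->] /mapP[y /vbasis_mem ay ->].
    case: aM => _ aA _; apply/eqP; rewrite -subr_eq0.
    by rewrite -[_ - _]/(mxlie (phi x) (phi y)) -phi_lie aA // phi0.
  by move=> _ /mapP[x /vbasis_mem ax ->]; case: (std x ax).
exists Pc => // h ah.
have [d Pd] : exists d, Pc *m phi h = diag_mx d *m Pc.
  have /all_sig[dd ddP] : forall i : 'I_(\dim a),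
      {d | Pc *m phi (vbasis a)`_i = diag_mx d *m Pc}.
    move=> i; apply: cid; have /Pcd : phi (vbasis a)`_i \in [seq phi h | h <- vbasis a].
      by apply/map_f/mem_nth; rewrite size_tuple.
    case/diagonalizable_forPex => d /(simmxPp _) Pd; exists d.
    by rewrite Pd // stablemx_unit.
  exists (\sum_i iota (coord (vbasis a) i h) *: dd i).
  rewrite {1}(coord_vbasis ah) phi_sum mulmx_sumr raddf_sum mulmx_suml.
  apply: eq_bigr => i _; rewrite phiZ -scalemxAr ddP.
  by rewrite /= scalemxAl; congr (_ *m _); apply/matrixP => u v; rewrite !mxE mulrnAr.
exists d => // i; have [_] := std h ah; apply; apply/eigenvalueP.
exists (row i Pc).
  by rewrite -row_mul Pd; apply/rowP => j; rewrite mul_diag_mx !mxE.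
apply/eqP => ri; have /rowP/(_ i) := congr1 (row i) (mulmxV Pcu); rewrite row_mul ri mul0mx !mxE eqxx.
by move/eqP; rewrite eq_sym oner_eq0.
Qed.

Lemma iwasawa_a_witt : exists2 P, P *m J *m adj P = S &
  forall h, h \in a -> exists2 t : 'rV_r, forall i, t 0 i \is Num.real &
    P *m phi h = diag_mx (torus_row k t) *m P.
Proof.
have [Pc Pcu Pcd] := iwasawa_a_diagonal.
have [||P PJ PA] := @witt_basis K sg sgE sqrtK r k
    (fun A => exists2 h, h \in a & A = phi h) Pc Pcu.
- by move=> _ [h /iwasawa_a_mem[/gP[]] ? _ _ ->].
- by move=> _ [h ah ->]; apply: Pcd.
by exists P => // h ah; apply: PA; exists h.
Qed.

(** A diagonal element commutes with a and is diagonalizable on g. *)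
Lemma torus_in_a P t : P *m J *m adj P = S ->
  (forall h, h \in a -> exists2 t : 'rV_r, forall i, t 0 i \is Num.real &
    P *m phi h = diag_mx (torus_row k t) *m P) ->
  from_coordinates P (diag_mx (torus_row k (map_mx iota t))) \in a.
Proof.
move=> PJ Pa; set z := from_coordinates _ _.
have Pz := from_coordinatesK PJ (diag_mx (torus_row k (map_mx iota t))); rewrite -/z in Pz.
have tr i : (map_mx iota t) 0 i \is Num.real by rewrite mxE.
have gz : z \in g.
  move: (Pz); rewrite (parabolic_torus sgE) // => Pz'.
  apply: (coordinates_mem PJ Pz'); first by rewrite adj0 addr0.
  by move=> i; rewrite !mxE eqxx mulr1n.
apply: (max_split unitary_subalgebra thetaC erefl aM) => //.
  move=> x ax; have [u _ Px] := Pa x ax.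
  apply: (@coordinates_inj _ PJ _ _ 0); last by rewrite phi0 mulmx0 mul0mx.
  rewrite (lie_coordinates Px Pz); congr (_ *m P).
  by rewrite /mxlie diag_mxC subrr.
apply: (@torus_ad_semisimple _ PJ (fun i => torus_row k t 0 i)) => //.
rewrite Pz; congr (diag_mx _ *m P); apply/rowP => j; rewrite !mxE.
by case: split => // i; rewrite !mxE //; case: split => l; rewrite !mxE ?rmorphN ?rmorph0.
Qed.

(** The weights eps_i, - eps_i, 0 of the basis vectors e_i, f_i, w_l. *)
Definition weight (eps : 'I_r -> dual a) (u : 'I_n) : dual a :=
  match split u with
  | inl i => eps i
  | inr v => match split v with inl i => - eps i | inr _ => 0 end
  end.

(** The last condition says that a is the whole torus, with coordinates eps_i. *)
Definition adapted P (eps : 'I_r -> dual a) := [/\ P *m J *m adj P = S,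
  forall h : subvs_of a,
    P *m phi (vsval h) = diag_mx (\row_u iota (weight eps u h)) *m P
  & forall t : 'I_r -> R, exists h : subvs_of a, forall i, eps i h = t i].

Lemma split_l m p (i : 'I_m) : split (lshift p i) = inl i.
Proof. exact: (unsplitK (inl i)). Qed.
Lemma split_r m p (i : 'I_p) : split (rshift m i) = inr i.
Proof. exact: (unsplitK (inr i)). Qed.

Variant index3_spec : 'I_n -> Type :=
| IndexE i : index3_spec (lshift (r + k) i)
| IndexF i : index3_spec (rshift r (lshift k i))
| IndexW l : index3_spec (rshift r (rshift r l)).

Lemma index3P u : index3_spec u.
Proof.
rewrite -(splitK u); case: (split u) => [i|v] /=; first exact: IndexE.
by rewrite -(splitK v); case: (split v) => [i|l] /=; [apply: IndexF|apply: IndexW].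
Qed.

Lemma weightE eps i : weight eps (lshift (r + k) i) = eps i.
Proof. by rewrite /weight split_l. Qed.
Lemma weightF eps i : weight eps (rshift r (lshift k i)) = - eps i.
Proof. by rewrite /weight split_r split_l. Qed.
Lemma weightW eps l : weight eps (rshift r (rshift r l)) = 0.
Proof. by rewrite /weight !split_r. Qed.

Lemma adapted_exists : exists P eps, adapted P eps.
Proof.
have [P PJ Pa] := iwasawa_a_witt; have Pu := witt_unit PJ.
have diagE h (t : 'rV_r) i : P *m phi h = diag_mx (torus_row k t) *m P ->
    (P *m phi h *m invmx P) (lshift (r + k) i) (lshift (r + k) i) = t 0 i.
  by move=> ->; rewrite mulmxK // mxE eqxx mulr1n row_mxEl.
have /choice[f fP] : forall x : 'I_r * subvs_of a, exists c, iota c =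
    (P *m phi (vsval x.2) *m invmx P) (lshift (r + k) x.1) (lshift (r + k) x.1).
  move=> [i h]; have [t tr Pt] := Pa _ (subvsP h).
  by have [c] := real_iota (tr i); exists c; rewrite (diagE _ _ _ Pt).
have fl i : linear (fun h => f (i, h) : R^o).
  move=> c x y; apply: (fmorph_inj iota); rewrite fP /= rmorphD rmorphM !fP /=.
  by rewrite phi_linear mulmxDr mulmxDl -scalemxAr -scalemxAl !mxE.
have /choice[eps epsE] i := hom_of_linear (fl i).
have epsP h t i : P *m phi (vsval h) = diag_mx (torus_row k t) *m P ->
    iota (eps i h) = t 0 i.
  by move=> Pt; rewrite epsE fP /= (diagE _ _ _ Pt).
exists P, eps; split=> // [h|t].
  have [t tr Pt] := Pa _ (subvsP h).
  rewrite Pt; congr (diag_mx _ *m P); apply/rowP => u; rewrite [RHS]mxE /torus_row.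
  case: (index3P u) => i.
  - by rewrite row_mxEl weightE (epsP _ _ _ Pt).
  - by rewrite row_mxEr row_mxEl weightF opp_lfunE rmorphN (epsP _ _ _ Pt) mxE.
  - by rewrite row_mxEr row_mxEr weightW zero_lfunE rmorph0 mxE.
have za := torus_in_a (\row_i t i) PJ Pa; exists (Subvs za) => i.
apply: (fmorph_inj iota); rewrite (epsP (Subvs za) _ _ (from_coordinatesK PJ _)).
by rewrite !mxE.
Qed.

Lemma hom_neq0 (lam : dual a) h : (lam h : R) != 0 -> lam != 0.
Proof. by apply: contraNneq => ->; rewrite zero_lfunE. Qed.

Lemma adapted_neq0 P eps i : adapted P eps -> eps i != 0.
Proof.
case=> _ _ /(_ (fun=> 1))[h hE]; apply: (@hom_neq0 _ h).
by rewrite hE oner_eq0.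
Qed.

Lemma adapted_add_neq0 P eps i j : adapted P eps -> eps i + eps j != 0.
Proof.
case=> _ _ /(_ (fun=> 1))[h hE]; apply: (@hom_neq0 _ h).
by rewrite add_lfunE !hE -[_ + _]/(1 *+ 2 : R) pnatr_eq0.
Qed.

Lemma adapted_sub_neq0 P eps i j : adapted P eps -> i != j -> eps i - eps j != 0.
Proof.
case=> _ _ /(_ (fun l => (l == i)%:R))[h hE] ij; apply: (@hom_neq0 _ h).
by rewrite add_lfunE opp_lfunE !hE eqxx (eq_sym j) (negPf ij) subr0 oner_eq0.
Qed.

(** Reversing the sign of eps_i amounts to exchanging e_i and f_i. *)
Section Flip.
Variable m : 'I_r -> bool.

Definition flip (u : 'I_n) : 'I_n :=
  match split u with
  | inl i => if m i then rshift r (lshift k i) else lshift (r + k) i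
  | inr v => match split v with
    | inl i => if m i then lshift (r + k) i else rshift r (lshift k i)
    | inr _ => u
    end
  end.

Lemma flipE i : flip (lshift (r + k) i) =
  if m i then rshift r (lshift k i) else lshift (r + k) i.
Proof. by rewrite /flip split_l. Qed.
Lemma flipF i : flip (rshift r (lshift k i)) =
  if m i then lshift (r + k) i else rshift r (lshift k i).
Proof. by rewrite /flip split_r split_l. Qed.
Lemma flipW l : flip (rshift r (rshift r l)) = rshift r (rshift r l).
Proof. by rewrite /flip !split_r. Qed.

Lemma witt_gram_flip u v : S (flip u) (flip v) = S u v.
Proof.
pose E := (block_mxEul, block_mxEur, block_mxEdl, block_mxEdr, row_mxEl, row_mxEr,
  col_mxEu, col_mxEd).
rewrite /witt_gram.
case: (index3P u) => i; case: (index3P v) => j; rewrite !(flipE, flipF, flipW).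
all: do ?case: (boolP (m i)) => mi; do ?case: (boolP (m j)) => mj; rewrite ?E ?mxE //.
all: by have [ij|] := eqVneq i j => //; move: mi; rewrite ij ?mj ?(negPf mj).
Qed.

Lemma adapted_flip P eps : adapted P eps ->
  adapted (rowsub flip P) (fun i => if m i then - eps i else eps i).
Proof.
case=> PJ Pd Pt; split.
- rewrite !mul_rowsub_mx; apply/matrixP => u v; rewrite mxE -witt_gram_flip -PJ.
  by rewrite mxE [RHS]mxE; apply: eq_bigr => j _; rewrite !mxE.
- move=> h; rewrite mul_rowsub_mx Pd; apply/matrixP => u v.
  rewrite mxE !mul_diag_mx !mxE; congr (iota _ * _).
  case: (index3P u) => i; rewrite ?flipE ?flipF ?flipW ?weightE ?weightF ?weightW //;
    by case: ifP; rewrite ?weightE ?weightF ?opprK.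
- move=> t; have [h hP] := Pt (fun i => if m i then - t i else t i).
  by exists h => i; case: ifP (hP i) => [|//]; rewrite opp_lfunE => _ ->; rewrite opprK.
Qed.

End Flip.

Lemma positive_adapted : exists P eps, adapted P eps /\ forall i, pos (eps i).
Proof.
have [P [eps Pe]] := adapted_exists.
exists (rowsub (flip (fun i => ~~ `[< pos (eps i) >])) P).
exists (fun i => if ~~ `[< pos (eps i) >] then - eps i else eps i).
split; first exact: adapted_flip.
move=> i; case: ifPn => [/asboolPn np|/negPn/asboolP//].
by case: posP => /(_ _ (adapted_neq0 i Pe))[].
Qed.

Section Positive.
Variables (P : 'M[K]_n) (eps : 'I_r -> dual a).
Hypothesis Pe : adapted P eps.
Hypothesis eps_pos : forall i, pos (eps i).

Lemma adapted_gram : P *m J *m adj P = S. Proof. by case: Pe. Qed.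
Let PJ := adapted_gram.
Let Pu : P \in unitmx := witt_unit PJ.

Lemma adapted_torus (h : subvs_of a) :
  P *m phi (vsval h) = diag_mx (\row_u iota (weight eps u h)) *m P.
Proof. by case: Pe. Qed.

Lemma adapted_diag h : h \in a -> exists2 t : 'rV_r, forall i, t 0 i \is Num.real &
  P *m phi h = diag_mx (torus_row k t) *m P.
Proof.
move=> ah; have e : vsval (Subvs ah) = h by [].
exists (\row_i iota (eps i (Subvs ah))) => [i|]; first by rewrite mxE.
rewrite -{1}e adapted_torus; congr (diag_mx _ *m P); apply/rowP => u.
rewrite mxE /torus_row; case: (index3P u) => i.
- by rewrite row_mxEl weightE mxE.
- by rewrite row_mxEr row_mxEl weightF opp_lfunE rmorphN !mxE.
- by rewrite !row_mxEr weightW zero_lfunE rmorph0 mxE.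
Qed.

Lemma bracket_coordinates x Y (h : subvs_of a) c : P *m phi x = Y *m P ->
  lie (vsval h) x = c *: x <->
  forall u v, Y u v != 0 -> c = weight eps u h - weight eps v h.
Proof.
move=> Px; have key := torus_bracket c (adapted_torus h) Px.
split=> [e u v Yuv|e].
  move: key; rewrite e subrr phi0 mulmx0 => /(congr1 (mulmx^~ (invmx P))).
  rewrite mul0mx mulmxK // => /matrixP/(_ u v)/esym/eqP; rewrite !mxE mulf_eq0.
  by rewrite (negPf Yuv) orbF fmorph_eq0 subr_eq0 eq_sym => /eqP.
apply/eqP; rewrite -subr_eq0; apply/eqP/(coordinates_inj PJ (Y := 0)).
  rewrite key; congr (_ *m P); apply/matrixP => u v; rewrite !mxE.
  have [->|/e->] := eqVneq (Y u v) 0; first by rewrite mulr0.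
  by rewrite subrr rmorph0 mul0r.
by rewrite phi0 mulmx0 mul0mx.
Qed.

(** The entry (u, v) of an element of g has root weight u - weight v. *)
Lemma root_vector_coordinates lam x Y : x \in g -> P *m phi x = Y *m P ->
  is_root_vector g lam x <->
  forall u v, Y u v != 0 -> lam = weight eps u - weight eps v.
Proof.
move=> gx Px; split=> [[_ e] u v Yuv|e].
  apply/lfunP => h; rewrite add_lfunE opp_lfunE.
  exact: (bracket_coordinates h (lam h) Px).1 (e h) u v Yuv.
split=> // h; apply/(bracket_coordinates h _ Px) => u v /e ->.
by rewrite add_lfunE opp_lfunE.
Qed.

(** This turns out to describe the Iwasawa component a + n. *)
Definition borel x := exists (A B : 'M[K]_r) (C : 'M[K]_(r, k)),
  [/\ forall i j, i != j -> A i j != 0 -> pos (eps i - eps j),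
      forall i, A i i \is Num.real, B + adj B = 0
    & P *m phi x = parabolic_mx sg A B C *m P].

Lemma borel_linear c x y : borel x -> borel y -> borel (c *: x + y).
Proof.
move=> [A [B [C [At Ad Bs Px]]]] [A' [B' [C' [At' Ad' Bs' Py]]]].
exists (iota c *: A + A'), (iota c *: B + B'), (iota c *: C + C'); split.
- move=> i j ij; rewrite !mxE; have [->|/(At _ _ ij)//] := eqVneq (A i j) 0.
  by rewrite mulr0 add0r; apply: At'.
- by move=> i; rewrite !mxE realD ?realM.
- rewrite adjD adjZ (sg_real sgE (iota_real c)) addrACA -scalerDr Bs Bs'.
  by rewrite scaler0 addr0.
- by rewrite phi_linear mulmxDr -scalemxAr Px Py parabolic_mxD parabolic_mxZ //
    mulmxDl scalemxAl.
Qed.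

Lemma borel0 : borel 0.
Proof.
exists 0, 0, 0; split; rewrite ?adj0 ?addr0 ?parabolic_mx0 ?phi0 ?mulmx0 ?mul0mx //.
  by move=> i j _; rewrite mxE eqxx.
by move=> i; rewrite mxE real0.
Qed.

Lemma borel_a h : h \in a -> borel h.
Proof.
case/adapted_diag => t tr Ph; exists (diag_mx t), 0, 0; split.
- by move=> i j ij; rewrite mxE (negPf ij) mulr0n eqxx.
- by move=> i; rewrite mxE eqxx mulr1n.
- by rewrite adj0 addr0.
- by rewrite Ph (parabolic_torus sgE).
Qed.

(** All blocks outside [parabolic_mx] have roots - eps_i - eps_j, - eps_i or 0,
    none of which is positive. *)
Lemma borel_root lam x : lam != 0 -> pos lam -> is_root_vector g lam x -> borel x.
Proof.
move=> lam0 lampos rx; have [gx _] := rx.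
pose Y := P *m phi x *m invmx P.
have Px : P *m phi x = Y *m P by rewrite mulmxKV.
have Yw := (root_vector_coordinates lam gx Px).1 rx.
have neg mu : pos mu -> lam = - mu -> False.
  by case: posP => _ excl _ _ mupos e; apply: (excl lam lam0); rewrite {2}e opprK.
have pos_add i j : pos (eps i + eps j) by case: posP => _ _ add _; apply: add.
pose A := ulsubmx Y; pose B := lsubmx (ursubmx Y); pose C := rsubmx (ursubmx Y).
pose D := usubmx (dlsubmx Y); pose G := dsubmx (dlsubmx Y).
pose E := ulsubmx (drsubmx Y); pose F := ursubmx (drsubmx Y).
pose H := dlsubmx (drsubmx Y); pose N := drsubmx (drsubmx Y).
have YE : Y = block_mx A (row_mx B C) (col_mx D G) (block_mx E F H N).
  by rewrite /A /B /C /D /G /E /F /H /N hsubmxK vsubmxK !submxK.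
have [gJ _] := (gP x).1 gx.
have [Bs EA HC _ [FG _]] := (gram_skew_blocks sgE YE).1 ((skew_coordinates PJ Px).1 gJ).
have D0 : D = 0.
  apply/matrixP => i j; rewrite [RHS]mxE; apply/eqP; apply: contraT => nz.
  have := Yw (rshift r (lshift k i)) (lshift (r + k) j).
  rewrite YE block_mxEdl col_mxEu weightF weightE -opprD => /(_ nz).
  by case/(neg _ (pos_add i j)).
have G0 : G = 0.
  apply/matrixP => i j; rewrite [RHS]mxE; apply/eqP; apply: contraT => nz.
  have := Yw (rshift r (rshift r i)) (lshift (r + k) j).
  rewrite YE block_mxEdl col_mxEd weightW weightE sub0r => /(_ nz).
  by case/(neg _ (eps_pos j)).
have N0 : N = 0.
  apply/matrixP => i j; rewrite [RHS]mxE; apply/eqP; apply: contraT => nz.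
  have := Yw (rshift r (rshift r i)) (rshift r (rshift r j)).
  rewrite YE block_mxEdr block_mxEdr !weightW subr0 => /(_ nz) lam00.
  by rewrite lam00 eqxx in lam0.
exists A, B, C; split=> //.
- move=> i j _ nz; rewrite -!weightE -(Yw (lshift (r + k) i) (lshift (r + k) j)) //.
  by rewrite YE block_mxEul.
- move=> i; have [->|nz] := eqVneq (A i i) 0; first exact: real0.
  have := Yw (lshift (r + k) i) (lshift (r + k) i).
  by rewrite YE block_mxEul subrr => /(_ nz) e; rewrite e eqxx in lam0.
- by rewrite parabolic_mxE Px YE EA HC FG D0 G0 N0 adj0.
Qed.

Lemma borel_component x : x \in (a + nn)%VS -> borel x.
Proof.
have [U UP] := vspace_of_predicate borel0 borel_linear.
have nU : (nn <= U)%VS.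
  by case: nnP => _; apply=> lam y [lam0 _] lampos ry; apply/UP/(borel_root lam0).
move=> /memv_addP[h ah [y ny ->]]; rewrite -[h]scale1r; apply: borel_linear.
  exact: borel_a.
exact/UP/(subvP nU).
Qed.

Local Notation X A B C := (from_coordinates P (parabolic_mx sg A B C)).

Lemma from_coordinatesD Y Z :
  from_coordinates P (Y + Z) = from_coordinates P Y + from_coordinates P Z.
Proof. by apply: phi_inj; rewrite phiD !psiK mulmxDr mulmxDl. Qed.

Lemma parabolic_root_vector lam (A B : 'M[K]_r) (C : 'M[K]_(r, k)) : pos lam -> lam != 0 -> B + adj B = 0 ->
  (forall i, A i i \is Num.real) ->
  (forall i j, A i j != 0 -> lam = eps i - eps j) ->
  (forall i j, B i j != 0 -> lam = eps i + eps j) ->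
  (forall i l, C i l != 0 -> lam = eps i) -> X A B C \in nn.
Proof.
move=> lampos lam0 Bs Ar Al Bl Cl.
have PX := from_coordinatesK PJ (parabolic_mx sg A B C).
have gX := coordinates_mem PJ PX Bs Ar.
have [->|X0] := eqVneq (X A B C) 0; first exact: mem0v.
suff rX : is_root_vector g lam (X A B C).
  by case: nnP => + _; apply; [split; first exact: lam0; exists (X A B C)|exact: lampos|].
apply/(root_vector_coordinates lam gX PX) => u v; rewrite /parabolic_mx.
case: (index3P u) => i; case: (index3P v) => j; rewrite ?weightE ?weightF ?weightW;
  rewrite ?(block_mxEul, block_mxEur, block_mxEdl, block_mxEdr, row_mxEl, row_mxEr);
  rewrite ?mxE ?eqxx ?opprK ?subr0 ?add0r //.
- exact: Al.
- exact: Bl.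
- exact: Cl.
- by rewrite oppr_eq0 fmorph_eq0 => /Al ->; rewrite addrC.
- by rewrite fmorph_eq0; apply: Cl.
Qed.

Lemma mem_nn_A i j c : (i != j -> c != 0 -> pos (eps i - eps j)) -> i != j ->
  X (c *: delta_mx i j) 0 0 \in nn.
Proof.
move=> ijpos ij; have [->|c0] := eqVneq c 0.
  by rewrite scale0r parabolic_mx0 /from_coordinates mulmx0 mul0mx -phi0 phiK mem0v.
apply: (parabolic_root_vector (lam := eps i - eps j)); first exact: ijpos.
- exact: adapted_sub_neq0 Pe ij.
- by rewrite adj0 addr0.
- move=> l; rewrite !mxE; case: andP => [[/eqP-> /eqP e]|_]; last by rewrite mulr0 real0.
  by rewrite e eqxx in ij.
- move=> u v; rewrite !mxE; case: andP => [[/eqP-> /eqP->]//|_].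
  by rewrite mulr0 eqxx.
- by move=> u v; rewrite mxE eqxx.
- by move=> u v; rewrite mxE eqxx.
Qed.

(** Two symmetric entries at once, as B has to be skew-Hermitian. *)
Lemma mem_nn_B i j c : X 0 (c *: delta_mx i j - adj (c *: delta_mx i j)) 0 \in nn.
Proof.
apply: (parabolic_root_vector (lam := eps i + eps j)).
- by case: posP => _ _ add _; apply: add.
- exact: adapted_add_neq0 Pe.
- by rewrite adjB (adjK sgE) addrC subrKA subrr.
- by move=> l; rewrite mxE real0.
- by move=> u v; rewrite mxE eqxx.
- move=> u v; rewrite !mxE.
  case ij: ((u == i) && (v == j)); first by case/andP: ij => /eqP-> /eqP->.
  case ji: ((v == i) && (u == j)).
    by case/andP: ji => /eqP-> /eqP-> _; rewrite addrC.
  by rewrite mulr0 rmorph0 subrr eqxx.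
- by move=> u v; rewrite mxE eqxx.
Qed.

Lemma mem_nn_C i l c : X 0 0 (c *: delta_mx i l) \in nn.
Proof.
apply: (parabolic_root_vector (lam := eps i)) => //.
- exact: adapted_neq0 Pe.
- by rewrite adj0 addr0.
- by move=> u; rewrite mxE real0.
- by move=> u v; rewrite mxE eqxx.
- by move=> u v; rewrite mxE eqxx.
- move=> u v; rewrite !mxE; case: andP => [[/eqP->]//|_].
  by rewrite mulr0 eqxx.
Qed.

Lemma from_coordinates0 : X 0 0 0 = 0.
Proof. by rewrite parabolic_mx0 /from_coordinates mulmx0 mul0mx -phi0 phiK. Qed.

(** The diagonal of A gives an element of a; its other entries and those of B
    and C give positive root vectors. *)
Lemma component_borel x : borel x -> x \in (a + nn)%VS.
Proof.
move=> [A [B [C [At Ad Bs Px]]]].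
have [t tE] : exists t : 'rV[R]_r, \row_i A i i = map_mx iota t.
  have /choice[t tE] i := real_iota (Ad i).
  by exists (\row_i t i); apply/rowP => i; rewrite !mxE.
pose A' := \matrix_(i, j) (if i == j then 0 else A i j).
have AE : A = diag_mx (map_mx iota t) + A'.
  apply/matrixP => i j; rewrite -tE !mxE; case: eqP => [->|_].
    by rewrite mulr1n addr0.
  by rewrite mulr0n add0r.
have XA M M' : X (M + M') 0 0 = X M 0 0 + X M' 0 0.
  by rewrite -from_coordinatesD -parabolic_mxD !addr0.
have hA : X A' 0 0 \in nn.
  rewrite [A']matrix_sum_delta; apply: (big_ind (fun M => X M 0 0 \in nn)).
  - by rewrite from_coordinates0 mem0v.
  - move=> M M' hM hM'.
    rewrite (XA M M').
    exact: (memvD hM hM').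
  move=> i _; apply: (big_ind (fun M => X M 0 0 \in nn)).
  - by rewrite from_coordinates0 mem0v.
  - move=> M M' hM hM'.
    rewrite (XA M M').
    exact: (memvD hM hM').
  move=> j _; have [<-|ij] := eqVneq i j.
    by rewrite mxE eqxx scale0r from_coordinates0 mem0v.
  by apply: mem_nn_A => // _; rewrite mxE (negPf ij); apply: At.
have XB M M' : X 0 (M + M' - adj (M + M')) 0 =
    X 0 (M - adj M) 0 + X 0 (M' - adj M') 0.
  by rewrite -from_coordinatesD -parabolic_mxD !addr0 adjD opprD addrACA.
have hB : X 0 B 0 \in nn.
  (* each entry of B / 2 contributes itself and its mirror image *)
  have -> : B = 2^-1 *: B - adj (2^-1 *: B).
    rewrite adjZ (sg_real sgE) ?realV ?realn // -scalerBr.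
    have -> : adj B = - B by apply/eqP; rewrite -addr_eq0 addrC Bs.
    by rewrite opprK -mulr2n -[B *+ 2]scaler_nat scalerA mulVf ?scale1r // pnatr_eq0.
  rewrite [2^-1 *: B]matrix_sum_delta.
  apply: (big_ind (fun M => X 0 (M - adj M) 0 \in nn)).
  - by rewrite adj0 subr0 from_coordinates0 mem0v.
  - move=> M M' hM hM'.
    rewrite (XB M M').
    exact: (memvD hM hM').
  move=> i _; apply: (big_ind (fun M => X 0 (M - adj M) 0 \in nn)).
  - by rewrite adj0 subr0 from_coordinates0 mem0v.
  - move=> M M' hM hM'.
    rewrite (XB M M').
    exact: (memvD hM hM').
  by move=> j _; apply: mem_nn_B.
have XC M M' : X 0 0 (M + M') = X 0 0 M + X 0 0 M'.
  by rewrite -from_coordinatesD -parabolic_mxD !addr0.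
have hC : X 0 0 C \in nn.
  rewrite [C]matrix_sum_delta; apply: (big_ind (fun M => X 0 0 M \in nn)).
  - by rewrite from_coordinates0 mem0v.
  - move=> M M' hM hM'.
    rewrite (XC M M').
    exact: (memvD hM hM').
  move=> i _; apply: (big_ind (fun M => X 0 0 M \in nn)).
  - by rewrite from_coordinates0 mem0v.
  - move=> M M' hM hM'.
    rewrite (XC M M').
    exact: (memvD hM hM').
  by move=> j _; apply: mem_nn_C.
have ht : X (diag_mx (map_mx iota t)) 0 0 \in a.
  rewrite -(parabolic_torus sgE); last by move=> i; rewrite mxE.
  exact: torus_in_a PJ adapted_diag.
have -> : x = X (diag_mx (map_mx iota t)) 0 0 + (X A' 0 0 + X 0 B 0 + X 0 0 C).
  apply: (coordinates_inj PJ Px); rewrite -!from_coordinatesD -!parabolic_mxD.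
  by rewrite from_coordinatesK // !addr0 !add0r -AE.
exact: memv_add ht (memvD (memvD hA hB) hC).
Qed.

End Positive.

End Iwasawa.

(** The relation lt records which of the eps_i - eps_j are positive. *)
Definition borel_coordinates P (lt : rel 'I_r) x :=
  exists (A B : 'M[K]_r) (C : 'M[K]_(r, k)),
  [/\ forall i j, i != j -> A i j != 0 -> lt i j,
      forall i, A i i \is Num.real, B + adj B = 0
    & P *m phi x = parabolic_mx sg A B C *m P].

Theorem iwasawa_component_borel s : is_iwasawa_component g s ->
  exists P (lt : rel 'I_r), [/\ P *m J *m adj P = S,
    forall i j, i != j -> lt i j = ~~ lt j i
    & forall x, x \in s <-> borel_coordinates P lt x].
Proof.
case=> kk [a [nn [[theta [pos [thetaC _ aM [posP nnP] _]]] ->]]].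
have [P [eps [Pe epos]]] := positive_adapted thetaC aM posP.
exists P, (fun i j => `[< pos (eps i - eps j) >]); split.
- exact: adapted_gram Pe.
- move=> i j ij; have ne := adapted_sub_neq0 Pe ij.
  case: posP => tot excl _ _; apply/asboolP/asboolPn; rewrite -[eps j - _]opprB.
    by move=> p1 p2; apply: (excl _ ne).
  by case: (tot _ ne).
- move=> x; split.
    move/(borel_component posP nnP Pe epos) => [A [B [C [At Ad Bs Px]]]].
    by exists A, B, C; split=> // i j ij /(At i j ij) /asboolP.
  move=> [A [B [C [At Ad Bs Px]]]]; apply: (component_borel thetaC aM posP nnP Pe epos).
  by exists A, B, C; split=> // i j ij /(At i j ij) /asboolP.
Qed.

End UnitaryIwasawa.

(** * Irreducibility of the standard representations *)

Section Boosts.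
Variables (p q : nat).
Local Notation n := (p + q)%N.

Definition sgn_row (K : pzRingType) : 'rV[K]_n := row_mx (const_mx 1) (const_mx (- 1)).

Lemma Ipq_diag (K : pzRingType) : Ipq K p q = diag_mx (sgn_row K).
Proof. by rewrite /sgn_row diag_mx_row !diag_const_mx raddfN. Qed.

Lemma sgn_row_sq (K : pzRingType) i : sgn_row K 0 i * sgn_row K 0 i = 1.
Proof.
rewrite mxE; case: split => j; rewrite mxE; first exact: mulr1.
by rewrite mulrNN mulr1.
Qed.

Lemma map_sgn_row (K K' : pzRingType) (f : {rmorphism K -> K'}) i :
  f (sgn_row K 0 i) = sgn_row K' 0 i.
Proof. by rewrite !mxE; case: split => j; rewrite !mxE ?rmorphN rmorph1. Qed.

(** For i != j, the combination of the units at (i, j) and (j, i) that lies in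
    so(p, q) when a = b and in su(p, q) when a and b are conjugate. *)
Definition boost (K : comPzRingType) (a b : K) (i j : 'I_n) : 'M[K]_n :=
  a *: delta_mx i j - (b * (sgn_row K 0 i * sgn_row K 0 j)) *: delta_mx j i.

Lemma boost_skew (K : comPzRingType) (f : {rmorphism K -> K}) (a b : K) i j :
  f a = b -> f b = a ->
  map_mx f (boost a b i j)^T *m Ipq K p q + Ipq K p q *m boost a b i j = 0.
Proof.
move=> fa fb; rewrite Ipq_diag /boost.
move: (map_sgn_row f) (sgn_row_sq K); move: (sgn_row K) => e fe e2.
apply/matrixP => u v; rewrite mxE mul_mx_diag mul_diag_mx.
rewrite !(mxE, rmorphB, rmorphM) !rmorph_nat fa fb !fe.
rewrite [(v == i) && _]andbC [(v == j) && _]andbC mulrBl mulrBr.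
rewrite [X in _ + X = _]addrC addrACA.
have -> : b * ((u == j) && (v == i))%:R * e 0 v
    - e 0 u * (b * (e 0 i * e 0 j) * ((u == j) && (v == i))%:R) = 0.
  case: andP => [[/eqP-> /eqP->]|_]; last by rewrite !mulr0 mul0r subrr.
  by rewrite !mulr1 (mulrCA _ b) (mulrC (e 0 i)) (mulrA (e 0 j)) e2 mul1r subrr.
rewrite add0r addrC.
case: andP => [[/eqP-> /eqP->]|_]; last by rewrite !mulr0 mul0r subr0.
by rewrite !mulr1 -!mulrA e2 mulr1 mulrC subrr.
Qed.

Lemma boost_trace (K : comPzRingType) (a b : K) i j : i != j -> \tr (boost a b i j) = 0.
Proof.
move=> ij; apply: big1 => u _; rewrite !mxE.
case: (eqVneq u i) => [->|ui]; first by rewrite (negPf ij) !mulr0 subrr.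
by rewrite andbF !mulr0 subrr.
Qed.

(** The boosts with a = 1 and a = i combine to the matrix units, which move any
    nonzero vector onto every basis vector. *)
Lemma unitary_irreducible (C : numClosedFieldType) (U : 'M[C]_n) : (1 < n)%N ->
  (forall a i j, i != j -> (U *m boost a a^* i j <= U)%MS) -> U != 0 -> (1%:M <= U)%MS.
Proof.
move=> n1 stab U0.
have stabE i j : i != j -> (U *m delta_mx i j <= U)%MS.
  move=> ij; have -> : U *m delta_mx i j =
      2^-1 *: (U *m boost 1 1^* i j - 'i *: (U *m boost 'i 'i^* i j)).
    rewrite [X in _ - X]scalemxAr -mulmxBr scalemxAr; congr (U *m _).
    set sij := sgn_row C 0 i * sgn_row C 0 j.
    have -> : boost 1 1^* i j = delta_mx i j - sij *: delta_mx j i.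
      by rewrite /boost rmorph1 scale1r mul1r.
    have -> : 'i *: boost 'i 'i^* i j = - delta_mx i j - sij *: delta_mx j i.
      rewrite /boost conjCi scalerBr !scalerA -expr2 sqrCi scaleN1r mulrA mulrN.
      by rewrite -expr2 sqrCi opprK mul1r.
    rewrite opprD !opprK addrACA addNr addr0 -mulr2n -scaler_nat scalerA.
    by rewrite mulVf ?scale1r // pnatr_eq0.
  by rewrite scalemx_sub // addmx_sub ?stab // eqmx_opp scalemx_sub ?stab.
have /rowV0Pn[u uU u0] := U0.
have [b ub] : exists b, u 0 b != 0.
  by apply/existsP; apply: contraNT u0; rewrite negb_exists => /forallP u0;
    apply/eqP/rowP => b; rewrite mxE; apply/eqP; rewrite -[_ == _]negbK u0.
have uE j : u *m delta_mx b j = u 0 b *: delta_mx 0 j.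
  apply/rowP => l; rewrite !mxE (bigD1 b) //= !mxE eqxx /= big1 ?addr0 // => m mb.
  by rewrite mxE (negPf mb) mulr0.
have stabv (v : 'rV[C]_n) (i j : 'I_n) : i != j -> (v <= U)%MS -> (v *m delta_mx i j <= U)%MS.
  by move=> ij vU; apply: submx_trans (stabE i j ij); apply: submxMr.
have dj j : j != b -> (delta_mx (0 : 'I_1) j <= U)%MS.
  move=> jb; have := stabv u b j; rewrite eq_sym uE => /(_ jb uU).
  by rewrite eqmx_scale.
have [c cb] : exists c : 'I_n, c != b.
  have : (1 < #|'I_n|)%N by rewrite card_ord.
  by move/card_gt1P => [x [y [_ _ xy]]]; have [xb|] := eqVneq x b;
    [exists y; rewrite -xb eq_sym|exists x].
apply/row_subP => i; rewrite rowE mulmx1.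
have [->|/dj//] := eqVneq i b.
by have := stabv _ c b cb (dj c cb); rewrite mul_delta_mx.
Qed.

(** If u has a nonzero coordinate b, the boosts (b, j) and then (j, l) send u to
    a multiple of the l-th basis vector when b, j, l are distinct; this is where
    the dimension must be at least 3. *)
Lemma orthogonal_irreducible (C : numFieldType) (U : 'M[C]_n) : (2 < n)%N ->
  (forall i j, i != j -> (U *m boost 1 1 i j <= U)%MS) -> U != 0 -> (1%:M <= U)%MS.
Proof.
move=> n2 stab U0.
have stabv (v : 'rV[C]_n) (i j : 'I_n) : i != j -> (v <= U)%MS -> (v *m boost 1 1 i j <= U)%MS.
  by move=> ij vU; apply: submx_trans (stab i j ij); apply: submxMr.
have vE (v : 'rV[C]_n) i j : v *m delta_mx i j = v 0 i *: delta_mx 0 j.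
  apply/rowP => l; rewrite !mxE (bigD1 i) //= !mxE eqxx /= big1 ?addr0 // => m mb.
  by rewrite mxE (negPf mb) mulr0.
have vB (v : 'rV[C]_n) i j : v *m boost 1 1 i j =
    v 0 i *: delta_mx 0 j - (sgn_row C 0 i * sgn_row C 0 j * v 0 j) *: delta_mx 0 i.
  by rewrite /boost scale1r mul1r mulmxBr -scalemxAr !vE scalerA.
have /rowV0Pn[u uU u0] := U0.
have [b ub] : exists b, u 0 b != 0.
  by apply/existsP; apply: contraNT u0; rewrite negb_exists => /forallP u0;
    apply/eqP/rowP => b; rewrite mxE; apply/eqP; rewrite -[_ == _]negbK u0.
have third (x y : 'I_n) : exists z, (z != x) && (z != y).
  apply/existsP; apply: contraLR n2; rewrite negb_exists -leqNgt => /forallP xy.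
  have : [set: 'I_n] \subset [set x; y].
    by apply/subsetP => z _; have := xy z; rewrite negb_and !negbK !inE.
  by move/subset_leq_card/leq_trans; rewrite cardsT card_ord; apply; rewrite cards2; case: eqP.
have dj l : l != b -> (delta_mx (0 : 'I_1) l <= U)%MS.
  move=> lb; have [j /andP[jb jl]] := third b l.
  have := stabv _ j l jl (stabv u b j _ uU); rewrite eq_sym => /(_ jb).
  rewrite [X in (X <= _)%MS]vB vB !mxE !eqxx.
  rewrite (negPf jb) (negPf lb) (eq_sym l) (negPf jl) /= !(mulr0, mulr1, subr0).
  by rewrite scale0r subr0 eqmx_scale.
have [c /andP[cb _]] := third b b.
apply/row_subP => i; rewrite rowE mulmx1.
have [->|/dj//] := eqVneq i b.
have := stabv _ c b cb (dj c cb); rewrite vB !mxE !eqxx /= eq_sym (negPf cb).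
by rewrite scale1r mulr0 scale0r subr0.
Qed.

End Boosts.

(** * The Lie algebras so(p, q) and su(p, q) *)

(** The definitions have rows and columns exchanged; conjugation by the
    involution Ipq passes from one form to the other. *)
Lemma skew_transpose (K : numFieldType) (sg : {rmorphism K -> K}) p q
    (X : 'M[K]_(p + q)) :
  adj sg X *m Ipq K p q + Ipq K p q *m X = 0 <->
  X *m Ipq K p q + Ipq K p q *m adj sg X = 0.
Proof.
have key (Y Z : 'M[K]_(p + q)) : Y *m Ipq K p q + Ipq K p q *m Z = 0 ->
    Z *m Ipq K p q + Ipq K p q *m Y = 0.
  move=> /(congr1 (fun M => Ipq K p q *m M *m Ipq K p q)).
  rewrite mulmxDr mulmxDl mulmx0 mul0mx !mulmxA Ipq_mul mul1mx.
  by rewrite -(mulmxA _ (Ipq _ _ _) (Ipq _ _ _)) Ipq_mul mulmx1 addrC.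
by split; apply: key.
Qed.

Lemma so_mem (R : realType) p q (X : 'M[R]_(p + q)) :
  X \in so R p q <->
  X *m Ipq R p q + Ipq R p q *m adj idfun X = 0 /\ \tr X = 0.
Proof.
have aX : adj idfun X = X^T by rewrite /adj map_mx_id.
split=> [/soP XJ|[XJ _]]; last by apply/soP; rewrite -aX; apply/skew_transpose.
have XJ' : X *m Ipq R p q + Ipq R p q *m adj idfun X = 0.
  by apply/skew_transpose; rewrite aX.
split=> //; apply/eqP; rewrite -eqNr.
have e : X = - (Ipq R p q *m X^T *m Ipq R p q).
  apply/eqP; rewrite -addr_eq0 -aX; apply/eqP.
  move/(congr1 (mulmx^~ (Ipq R p q))): XJ'.
  by rewrite mulmxDl mul0mx -(mulmxA _ (Ipq _ _ _) (Ipq _ _ _)) Ipq_mul mulmx1.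
by rewrite {1}e raddfN /= opprK mxtrace_mulC mulmxA Ipq_mul mul1mx mxtrace_tr.
Qed.

Lemma su_mem (R : realType) p q (X : cmx R (p + q)) :
  X \in su R p q <->
  (X : 'M_(p + q)) *m Ipq R[i] p q
    + Ipq R[i] p q *m adj (@conjc R) (X : 'M_(p + q)) = 0 /\
  \tr (X : 'M[R[i]]_(p + q)) = 0.
Proof.
split=> [/suP[XJ tX]|[XJ tX]].
  by split=> //; apply/skew_transpose; exact: XJ.
by apply/suP; split=> //; have := (skew_transpose (@conjc R) (X : 'M_(p + q))).2 XJ.
Qed.

Lemma so_ad_standard (R : realType) p q (h : 'M[R]_(p.+1 + q)) : (1 < p + q)%N ->
  h \in so R p.+1 q -> ad_semisimple (so R p.+1 q) h -> diagonalizable h.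
Proof.
move=> pq gh hss; pose rC := real_complex R.
have [|||||rs urs dvd] := @ad_semisimple_standard R _ (so R p.+1 q) (p + q) (map_mx rC) _ _ _ _ h gh _ hss.
- exact: map_mxD.
- exact: map_mxZ.
- by move=> x y; rewrite /lie /= /mxlie map_mxB !map_mxM.
- move=> U stab; apply: (@orthogonal_irreducible p.+1 q) => // i j ij.
  have -> : boost 1 1 i j = map_mx rC (boost 1 1 i j).
    by rewrite /boost map_mxB !map_mxZ !map_delta_mx !rmorphM !rmorph1 !map_sgn_row.
  apply: stab; apply/so_mem; split; last exact: boost_trace.
  by apply/skew_transpose; apply: boost_skew.
- by rewrite trace_map_mx; have [_ ->] := (so_mem h).1 gh; rewrite rmorph0.
apply/(@diagonalizableP _ (p + q)); exists rs => //.
rewrite -(dvdp_map rC) -mxminpoly_map rmorph_prod /=.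
under eq_bigr => r _ do rewrite rmorphB /= map_polyX map_polyC.
exact: dvd.
Qed.

Lemma su_ad_standard (R : realType) p q (h : cmx R (p.+1 + q)) : (0 < p + q)%N ->
  h \in su R p.+1 q -> ad_semisimple (su R p.+1 q) h ->
  diagonalizable (h : 'M[R[i]]_(p.+1 + q)) /\
  forall c, eigenvalue (h : 'M[R[i]]_(p.+1 + q)) c -> c \is Num.real.
Proof.
move=> pq gh hss; pose rC := real_complex R.
have [|||||rs urs dvd] := @ad_semisimple_standard R _ (su R p.+1 q) (p + q)
  (fun x : cmx R (p.+1 + q) => x : 'M[R[i]]_(p.+1 + q)) _ _ _ _ h gh _ hss.
- by [].
- by [].
- by [].
- move=> U stab; apply: (@unitary_irreducible p.+1 q) => // a i j ij.
  apply: (stab (boost a a^* i j : cmx R (p.+1 + q))); apply/su_mem; split.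
    by apply/skew_transpose; apply: boost_skew => //; apply: (@conjCK _ a).
  exact: boost_trace.
- by have [_ ->] := (su_mem h).1 gh.
split.
  apply/(@diagonalizableP _ (p + q)); exists (map rC rs).
    by rewrite map_inj_uniq //; apply: fmorph_inj.
  by rewrite big_map.
move=> c; rewrite (@eigenvalue_root_min _ (p + q)) => rc.
have : root (\prod_(r <- rs) ('X - (rC r)%:P)) c.
  by have /dvdpP[P ->] := dvd; rewrite rootM rc orbT.
rewrite -(big_map rC predT (fun z => 'X - z%:P)) root_prod_XsubC => /mapP[x _ ->].
by rewrite complex_real.
Qed.

(** * Heisenberg extensions *)

Section Heisenberg.
Variable R : realType.

(** The coordinates of (t, z, x, y) are those of the grading element, of the
    centre of the Heisenberg algebra and of two Lagrangian subspaces.  For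
    k = 0 it is the two-dimensional nonabelian algebra. *)
Definition heis (k : nat) : Type := (R^o * R^o * 'rV[R]_k * 'rV[R]_k)%type.
HB.instance Definition _ k := Vector.on (heis k).

Definition symplectic k (x y x' y' : 'rV[R]_k) : R :=
  (x *m y'^T) 0 0 - (x' *m y^T) 0 0.

Definition heis_lie k (u v : heis k) : heis k :=
  let: (t, z, x, y) := u in let: (t', z', x', y') := v in
  (0, 2 * (t * z' - t' * z) + symplectic x y x' y',
   t *: x' - t' *: x, t *: y' - t' *: y).

Definition is_heis k (L : lieAlgType R) (s : {vspace L}) :=
  exists F : 'Hom(heis k, L), [/\ lker F == 0%VS, limg F = s
    & forall u v, lie (F u) (F v) = F (heis_lie u v)].

Lemma heis_isomorphic k (L L' : lieAlgType R) (s : {vspace L}) (s' : {vspace L'}) :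
  is_heis k s -> is_heis k s' -> lie_isomorphic s s'.
Proof.
case=> F [kF <- FM] [F' [kF' <- FM']]; have FK := lker0_lfunK kF.
have fF u : (F' \o F^-1)%VF (F u) = F' u by rewrite comp_lfunE FK.
exists (F' \o F^-1)%VF; split.
- apply/eqP; rewrite -subv0; apply/subvP => _ /memv_capP[/memv_imgP[u _ ->]].
  rewrite memv_ker fF => /eqP Fu; rewrite memv0.
  have : u \in lker F' by rewrite memv_ker Fu.
  by rewrite (eqP kF') memv0 => /eqP->; rewrite linear0.
- apply/vspaceP => y; apply/memv_imgP/memv_imgP => [[_ /memv_imgP[u _ ->] ->]|[u _ ->]].
    by exists u; rewrite ?memvf.
  by exists (F u); rewrite ?memv_img ?memvf ?fF.
- by move=> _ _ /memv_imgP[u _ ->] /memv_imgP[v _ ->]; rewrite FM !fF FM'.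
Qed.

Lemma heis_image k (L : lieAlgType R) (F : heis k -> L) :
  linear F -> injective F -> (forall u v, lie (F u) (F v) = F (heis_lie u v)) ->
  exists2 s : {vspace L}, forall x, x \in s <-> exists u, x = F u & is_heis k s.
Proof.
move=> Fl Finj FM; have [G GE] := hom_of_linear Fl.
exists (limg G) => [x|].
  split=> [/memv_imgP[u _ ->]|[u ->]]; first by exists u.
  by rewrite -GE memv_img ?memvf.
exists G; split=> // [|u v]; last by rewrite !GE.
by apply/lker0P => u v; rewrite !GE; apply: Finj.
Qed.

End Heisenberg.

(** * The two Iwasawa components *)

Section Components.
Variables (R : realType) (K : numFieldType).
Variables (sg : {rmorphism K -> K}) (iota : {rmorphism R -> K}).
Hypothesis sgE : forall x, x * sg x = `|x| ^+ 2.
Hypothesis iota_real : forall c, iota c \is Num.real.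
Variables (r k k' : nat) (L : lieAlgType R).
Local Notation n := (r + (r + k))%N.
Variables (phi : L -> 'M[K]_n) (psi : 'M[K]_n -> L).
Hypothesis phi_linear : forall c x y, phi (c *: x + y) = iota c *: phi x + phi y.
Hypothesis phiK : cancel phi psi.
Hypothesis psiK : cancel psi phi.
Hypothesis phi_lie : forall x y, phi (lie x y) = mxlie (phi x) (phi y).
Variable P : 'M[K]_n.
Hypothesis PJ : P *m Ipq K r (r + k) *m adj sg P = @witt_gram K r k.

(** Linear families A, B, C of blocks whose parabolic matrices multiply as in
    [heis k'] define a subspace of L of this type. *)
Lemma heis_parabolic (A B : heis R k' -> 'M[K]_r)
    (C : heis R k' -> 'M[K]_(r, k)) :
  (forall c u v, [/\ A (c *: u + v) = iota c *: A u + A v,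
     B (c *: u + v) = iota c *: B u + B v & C (c *: u + v) = iota c *: C u + C v]) ->
  (forall u v, A u = A v -> B u = B v -> C u = C v -> u = v) ->
  (forall u v, mxlie (parabolic_mx sg (A u) (B u) (C u)) (parabolic_mx sg (A v) (B v) (C v))
     = parabolic_mx sg (A (heis_lie u v)) (B (heis_lie u v)) (C (heis_lie u v))) ->
  exists2 s : {vspace L}, forall x, x \in s <-> exists u,
     P *m phi x = parabolic_mx sg (A u) (B u) (C u) *m P & is_heis k' s.
Proof.
move=> lin inj M.
pose F u := from_coordinates psi P (parabolic_mx sg (A u) (B u) (C u)).
have FE u : P *m phi (F u) = parabolic_mx sg (A u) (B u) (C u) *m P.
  exact: (from_coordinatesK psiK PJ).
have Funiq x u : P *m phi x = parabolic_mx sg (A u) (B u) (C u) *m P -> x = F u.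
  by move=> Px; apply: (coordinates_inj phiK PJ Px).
have [|||s sP sH] := @heis_image _ _ _ F.
- move=> c u v; apply/esym/Funiq; have [-> -> ->] := lin c u v.
  by rewrite phi_linear mulmxDr -scalemxAr !FE parabolic_mxD parabolic_mxZ // mulmxDl
    scalemxAl.
- move=> u v e; have := FE u; rewrite e FE => /(congr1 (mulmx^~ (invmx P))).
  rewrite !mulmxK ?(witt_unit PJ) // => /parabolic_mx_inj[eA eB eC].
  exact/esym/inj.
- by move=> u v; apply: Funiq; rewrite (lie_coordinates phi_lie (FE u) (FE v)) M.
exists s => // x; split=> [/sP[u ->]|[u Px]]; first by exists u.
by apply/sP; exists u; apply: Funiq.
Qed.

End Components.

(** ** The component of su(1, k + 1) *)

Section SpecialUnitary.
Variable R : realType.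
Local Notation iota := (real_complex R).
Local Notation C := R[i].

Lemma conjc_norm (x : C) : x * conjc x = `|x| ^+ 2.
Proof. by rewrite sqr_normc. Qed.

Lemma complex_sqrt (x : C) : 0 <= x -> exists2 y : C, 0 <= y & y ^+ 2 = x.
Proof. by move=> x0; exists (sqrtC x); rewrite ?sqrtC_ge0 ?sqrtCK. Qed.

Lemma real_complex_real (c : R) : iota c \is Num.real.
Proof. by rewrite complex_real. Qed.

Lemma complex_real_exists (y : C) : y \is Num.real -> exists c, y = iota c.
Proof. by move=> yr; exists (complex.Re y); rewrite /= RRe_real. Qed.

Definition complexify k (x y : 'rV[R]_k) : 'rV[C]_k := \row_j (x 0 j +i* y 0 j)%C.

Lemma complexify_exists k (c : 'rV[C]_k) : exists x y, c = complexify x y.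
Proof.
exists (map_mx (@complex.Re R) c), (map_mx (@complex.Im R) c).
by apply/rowP => j; rewrite !mxE; case: (c 0 j).
Qed.

Lemma complexify_inj k (x y x' y' : 'rV[R]_k) :
  complexify x y = complexify x' y' -> x = x' /\ y = y'.
Proof.
by move=> /rowP e; split; apply/rowP => j; have := e j; rewrite !mxE => -[].
Qed.

Lemma complexify_linear k c (x y x' y' : 'rV[R]_k) :
  complexify (c *: x + x') (c *: y + y') =
  iota c *: complexify x y + complexify x' y'.
Proof. by apply/rowP => j; rewrite !mxE; apply/eqP; rewrite eq_complex /= !mul0r subr0 addr0 !eqxx. Qed.

(** Twice the imaginary part of the Hermitian product. *)
Lemma complexify_herm k (x y x' y' : 'rV[R]_k) :
  (complexify x y *m adj (@conjc R) (complexify x' y')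
   - complexify x' y' *m adj (@conjc R) (complexify x y)) 0 0 =
  (0 +i* (- 2 * symplectic x y x' y'))%C.
Proof.
apply/eqP; rewrite eq_complex /= !mxE -sumrB.
rewrite (raddf_sum (@complex.Re R)) (raddf_sum (@complex.Im R)) /=; apply/andP; split.
  apply/eqP/big1 => j _; rewrite !mxE /= !mulrN !opprK [x' 0 j * _]mulrC.
  by rewrite [y' 0 j * _]mulrC subrr.
rewrite /symplectic !mxE -sumrB mulr_sumr; apply/eqP/eq_bigr => j _; rewrite !mxE /=.
ring.
Qed.

(** The factor -2 absorbs the one of [complexify_herm], so that the central
    coordinate is z itself. *)
Definition su_B (z : R) : 'M[C]_1 := (0 +i* (- 2 * z))%C%:M.

Lemma su_heis k (t : {vspace cmx R (1 + (1 + k))}) :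
  is_iwasawa_component (su R 1 (1 + k)) t -> is_heis k t.
Proof.
move=> ht; pose phi (x : cmx R (1 + (1 + k))) : 'M[C]_(1 + (1 + k)) := x.
pose psi (x : 'M[C]_(1 + (1 + k))) : cmx R (1 + (1 + k)) := x.
have [||||||P [lt [PJ _ tP]]] := iwasawa_component_borel conjc_norm complex_sqrt
  real_complex_real complex_real_exists (phi := phi) (psi := psi) _ _ _ _ _ _ ht.
- by [].
- by [].
- by [].
- by [].
- by move=> x; exact: su_mem.
- move=> h gh hss; exact: (@su_ad_standard R 0 (1 + k) h).
have [||||||| t' t'P Ht'] := (heis_parabolic conjc_norm real_complex_real (phi := phi)
  (psi := psi) _ _ _ _ PJ
  (A := fun u : heis R k => (iota u.1.1.1)%:M) (B := fun u : heis R k => su_B u.1.1.2)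
  (C := fun u : heis R k => complexify u.1.2 u.2)).
- by [].
- by [].
- by [].
- by [].
- move=> c u v; split.
  + by rewrite /= rmorphD rmorphM raddfD /= scale_scalar_mx.
  + rewrite /su_B scale_scalar_mx -raddfD; congr (_%:M).
    by apply/eqP; rewrite eq_complex /= !mul0r !mulr0 addr0 subr0 addr0 eqxx mulrDr mulrCA eqxx.
  + exact: complexify_linear.
- move=> [[[a b] x] y] [[[a' b'] x'] y'] /=.
  move=> /matrixP/(_ 0 0); rewrite !mxE eqxx !mulr1n => /(fmorph_inj iota) ->.
  move=> /matrixP/(_ 0 0); rewrite !mxE eqxx !mulr1n => -[].
  move=> /(mulfI _) -> //; last by rewrite oppr_eq0 pnatr_eq0.
  by case/complexify_inj => -> ->.
- move=> [[[a b] x] y] [[[a' b'] x'] y'] /=; rewrite parabolic_mx_lie.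
  apply: f_equal3.
  + by rewrite -!scalar_mxM mulrC subrr raddf0.
  + rewrite [C in _ + C]mx11_scalar complexify_herm /su_B !adj_scalar.
    rewrite -!scalar_mxM -!raddfD -!raddfN -!raddfD; congr (_%:M).
    by apply/eqP; rewrite eq_complex /=; apply/andP; split; apply/eqP; ring.
  + rewrite !mul_scalar_mx; apply/rowP => j; rewrite !mxE.
    by apply/eqP; rewrite eq_complex /=; apply/andP; split; apply/eqP; ring.
suff -> : t = t' by [].
apply/vspaceP => x; apply/idP/idP => [/tP[A [B [D [_ Ar Bs Px]]]]|/t'P[u Px]].
    have [c Ac] := complex_real_exists (Ar 0).
    have [x1 [y1 DE]] := complexify_exists D.
    have [z Bz] : exists z, B = su_B z.
      exists (- (complex.Im (B 0 0)) / 2); rewrite /su_B [LHS]mx11_scalar; congr (_%:M).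
      move/matrixP/(_ 0 0): Bs; rewrite !mxE; case: (B 0 0) => p q /= [] p0 _.
      have {}p0 : p = 0 by move/eqP: p0; rewrite -mulr2n mulrn_eq0 => /eqP.
      by rewrite p0; apply/eqP; rewrite eq_complex /= eqxx; apply/eqP; field.
    have AE : A = (iota c)%:M by rewrite [LHS]mx11_scalar Ac.
    by apply/t'P; exists (c, z, x1, y1); rewrite Px AE Bz DE.
  apply/tP.
  exists (iota u.1.1.1)%:M, (su_B u.1.1.2), (complexify u.1.2 u.2); split=> //.
- by move=> i j; rewrite !ord1 eqxx.
- by move=> i; rewrite !mxE eqxx mulr1n real_complex_real.
- rewrite adj_scalar -raddfD -[RHS](raddf0 (@scalar_mx C 1)); congr (_%:M).
    by apply/eqP; rewrite eq_complex /= addr0 subrr eqxx.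
Qed.

End SpecialUnitary.

(** ** The component of so(2, k + 2) *)

Section TwoByTwo.
Variables (F : numFieldType) (i0 i1 : 'I_2).
Hypothesis i01 : i0 != i1.

(** Rows and columns are listed in the order i0, i1, which need not be 0, 1: it
    is the order in which A is upper triangular. *)
Definition mx2 (a b c d : F) : 'M[F]_2 := \matrix_(i, j)
  (if i == i0 then (if j == i0 then a else b) else (if j == i0 then c else d)).

Definition rows2 k (x y : 'rV[F]_k) : 'M[F]_(2, k) :=
  \matrix_(i, j) (if i == i0 then x 0 j else y 0 j).

Lemma index2 (i : 'I_2) : i = i0 \/ i = i1.
Proof.
move: i01; case: i0 i1 i => [[|[|//]] ?] [[|[|//]] ?] [[|[|//]] ?] // _;
  by [left; apply: val_inj|right; apply: val_inj].
Qed.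

Lemma sum2 (f : 'I_2 -> F) : \sum_i f i = f i0 + f i1.
Proof.
rewrite (bigD1 i0) //= (bigD1 i1) 1?eq_sym //= big1 ?addr0 // => i.
by case: (index2 i) => ->; rewrite eqxx ?andbF.
Qed.

Let i10 : (i1 == i0) = false. Proof. by rewrite eq_sym (negPf i01). Qed.

Lemma eq_rows2 k (A B : 'M[F]_(2, k)) :
  (forall j, A i0 j = B i0 j) -> (forall j, A i1 j = B i1 j) -> A = B.
Proof. by move=> e0 e1; apply/matrixP => i j; case: (index2 i) => ->. Qed.

Lemma mx2E (A : 'M[F]_2) : A = mx2 (A i0 i0) (A i0 i1) (A i1 i0) (A i1 i1).
Proof. by apply: eq_rows2 => j; rewrite mxE ?eqxx ?i10; case: (index2 j) => ->; rewrite ?eqxx ?i10. Qed.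
Lemma rows2E k (A : 'M[F]_(2, k)) : A = rows2 (row i0 A) (row i1 A).
Proof. by apply: eq_rows2 => j; rewrite !mxE ?sum2 ?mxE ?eqxx ?i10 ?mxE. Qed.

Lemma mx2_inj a b c d a' b' c' d' : mx2 a b c d = mx2 a' b' c' d' ->
  [/\ a = a', b = b', c = c' & d = d'].
Proof.
move/matrixP => e; move: (e i0 i0) (e i0 i1) (e i1 i0) (e i1 i1).
by rewrite !mxE !eqxx !i10.
Qed.
Lemma rows2_inj k (x y x' y' : 'rV[F]_k) : rows2 x y = rows2 x' y' -> x = x' /\ y = y'.
Proof.
move=> /matrixP e; split; apply/rowP => j; [move: (e i0 j)|move: (e i1 j)];
  by rewrite !mxE ?eqxx ?i10.
Qed.

Lemma mx2D a b c d a' b' c' d' :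
  mx2 a b c d + mx2 a' b' c' d' = mx2 (a + a') (b + b') (c + c') (d + d').
Proof. by apply: eq_rows2 => j; rewrite !mxE ?sum2 ?mxE ?eqxx ?i10; case: ifP. Qed.
Lemma mx2N a b c d : - mx2 a b c d = mx2 (- a) (- b) (- c) (- d).
Proof. by apply: eq_rows2 => j; rewrite !mxE ?sum2 ?mxE ?eqxx ?i10; case: ifP. Qed.
Lemma mx2Z l a b c d : l *: mx2 a b c d = mx2 (l * a) (l * b) (l * c) (l * d).
Proof. by apply: eq_rows2 => j; rewrite !mxE ?sum2 ?mxE ?eqxx ?i10; case: ifP. Qed.
Lemma mx2M a b c d a' b' c' d' : mx2 a b c d *m mx2 a' b' c' d' =
  mx2 (a * a' + b * c') (a * b' + b * d') (c * a' + d * c') (c * b' + d * d').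
Proof. by apply: eq_rows2 => j; rewrite !mxE ?sum2 ?mxE ?eqxx ?i10; case: ifP. Qed.
Lemma mx2_adj a b c d : adj idfun (mx2 a b c d) = mx2 a c b d.
Proof. by apply: eq_rows2 => j; rewrite !mxE ?sum2 ?mxE ?eqxx ?i10; case: ifP. Qed.
Lemma mx2_0 : 0 = mx2 0 0 0 0.
Proof. by apply: eq_rows2 => j; rewrite !mxE ?sum2 ?mxE ?eqxx ?i10; case: ifP. Qed.
Lemma rows2D k (x y x' y' : 'rV[F]_k) : rows2 x y + rows2 x' y' = rows2 (x + x') (y + y').
Proof. by apply: eq_rows2 => j; rewrite !mxE ?sum2 ?mxE ?eqxx ?i10 ?mxE. Qed.
Lemma rows2N k (x y : 'rV[F]_k) : - rows2 x y = rows2 (- x) (- y).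
Proof. by apply: eq_rows2 => j; rewrite !mxE ?sum2 ?mxE ?eqxx ?i10 ?mxE. Qed.
Lemma rows2Z k l (x y : 'rV[F]_k) : l *: rows2 x y = rows2 (l *: x) (l *: y).
Proof. by apply: eq_rows2 => j; rewrite !mxE ?sum2 ?mxE ?eqxx ?i10 ?mxE. Qed.
Lemma mx2_rows k a b c d (x y : 'rV[F]_k) :
  mx2 a b c d *m rows2 x y = rows2 (a *: x + b *: y) (c *: x + d *: y).
Proof. by apply: eq_rows2 => j; rewrite !mxE ?sum2 ?mxE ?eqxx ?i10 ?mxE. Qed.
Lemma rows2_0 k : 0 = rows2 (0 : 'rV[F]_k) 0.
Proof. by apply: eq_rows2 => j; rewrite !mxE ?sum2 ?mxE ?eqxx ?i10 ?mxE. Qed.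
Lemma rows2_adj k (x y x' y' : 'rV[F]_k) : rows2 x y *m adj idfun (rows2 x' y') =
  mx2 ((x *m x'^T) 0 0) ((x *m y'^T) 0 0) ((y *m x'^T) 0 0) ((y *m y'^T) 0 0).
Proof.
apply/matrixP => i j; rewrite [LHS]mxE [RHS]mxE.
by case: (index2 i) => ->; case: (index2 j) => ->; rewrite ?eqxx ?i10 mxE;
  apply: eq_bigr => l _; rewrite !mxE ?eqxx ?i10.
Qed.

End TwoByTwo.

Section Orthogonal.
Variables (R : realType) (k : nat) (i0 i1 : 'I_2).
Hypothesis i01 : i0 != i1.
Local Notation mx2 := (mx2 i0).
Local Notation rows2 := (rows2 i0).

(** Parabolic elements for an upper triangular diagonal block: the torus
    coordinates are a and d, the root vectors have coordinates b, z, x, y. *)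
Definition so_mx (a d b z : R) (x y : 'rV[R]_k) : 'M[R]_(2 + (2 + k)) :=
  parabolic_mx idfun (mx2 a b 0 d) (mx2 0 z (- z) 0) (rows2 x y).

Lemma dotC (x y : 'rV[R]_k) : (x *m y^T) 0 0 = (y *m x^T) 0 0.
Proof. by rewrite !mxE; apply: eq_bigr => i _; rewrite !mxE mulrC. Qed.

Lemma so_mx_lie a d b z x y a' d' b' z' x' y' :
  mxlie (so_mx a d b z x y) (so_mx a' d' b' z' x' y') =
  so_mx 0 0 ((a - d) * b' - (a' - d') * b)
    ((a + d) * z' - (a' + d') * z + symplectic x y x' y')
    (a *: x' + b *: y' - (a' *: x + b' *: y)) (d *: y' - d' *: y).
Proof.
rewrite /so_mx parabolic_mx_lie; apply: f_equal3.
- by rewrite !(mx2M i01) (mx2N i01) (mx2D i01); congr (mx2 _ _ _ _); ring.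
- rewrite !(mx2_adj i01) !(mx2M i01) !(rows2_adj i01).
  rewrite !(mx2D i01, mx2N i01) /symplectic.
  rewrite (dotC x' x) (dotC y' y) (dotC y' x) (dotC y x').
  by congr (mx2 _ _ _ _); ring.
- rewrite !(mx2_rows i01) (rows2N i01) (rows2D i01); congr (rows2 _ _).
  by rewrite !scale0r !add0r.
Qed.

Lemma so_mx_inj a d b z x y a' d' b' z' x' y' :
  so_mx a d b z x y = so_mx a' d' b' z' x' y' ->
  [/\ a = a', d = d', b = b' & [/\ z = z', x = x' & y = y']].
Proof.
case/parabolic_mx_inj => /(mx2_inj i01)[-> -> _ ->] /(mx2_inj i01)[_ -> _ _].
by case/(rows2_inj i01) => -> ->.
Qed.

Lemma so_mx_linear c a d b z x y a' d' b' z' x' y' :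
  so_mx (c * a + a') (c * d + d') (c * b + b') (c * z + z') (c *: x + x') (c *: y + y') =
  c *: so_mx a d b z x y + so_mx a' d' b' z' x' y'.
Proof.
rewrite /so_mx -parabolic_mxZ ?num_real // => [|u]; last by rewrite -expr2 real_normK ?num_real.
rewrite -parabolic_mxD !(mx2Z i01, mx2D i01, rows2Z i01, rows2D i01).
by rewrite !mulr0 !addr0 mulrN opprD.
Qed.

End Orthogonal.

Section OrthogonalComponent.
Variable R : realType.

Lemma real_norm (x : R) : x * (idfun : {rmorphism R -> R}) x = `|x| ^+ 2.
Proof. by rewrite real_normK ?num_real. Qed.

Lemma real_sqrt (x : R) : 0 <= x -> exists2 y : R, 0 <= y & y ^+ 2 = x.
Proof. by move=> x0; exists (Num.sqrt x); rewrite ?sqrtr_ge0 ?sqr_sqrtr. Qed.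

Lemma idfun_real (c : R) : (idfun : {rmorphism R -> R}) c \is Num.real.
Proof. exact: num_real. Qed.

Lemma idfun_onto (y : R) : y \is Num.real ->
  exists c, y = (idfun : {rmorphism R -> R}) c.
Proof. by exists y. Qed.

Lemma so_coordinates k (s : {vspace 'M[R]_(2 + (2 + k))}) :
  is_iwasawa_component (so R 2 (2 + k)) s ->
  exists (P : 'M[R]_(2 + (2 + k))) (i0 i1 : 'I_2), [/\ i0 != i1,
    P *m Ipq R 2 (2 + k) *m adj idfun P = witt_gram R 2 k
    & forall X, X \in s <-> exists a d b z x y,
        P *m X = so_mx i0 a d b z x y *m P].
Proof.
move=> hs; pose phi (x : 'M[R]_(2 + (2 + k))) := x.
have [||||||P [lt [PJ ltC sP]]] := iwasawa_component_borel real_norm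
  real_sqrt idfun_real idfun_onto (phi := phi) (psi := phi) _ _ _ _ _ _ hs.
- by [].
- by [].
- by [].
- by [].
- by move=> x; exact: so_mem.
- move=> h gh hss; split; last by move=> c _; apply: num_real.
  exact: (@so_ad_standard R 1 (2 + k) h).
have [i0 [i1 [i01 lt01]]] : exists i0 i1 : 'I_2, i0 != i1 /\ lt i0 i1.
  have [l01|l01] := boolP (lt ord0 ord_max); first by exists ord0, ord_max.
  by exists ord_max, ord0; split=> //; rewrite ltC.
exists P, i0, i1; split=> // X; split.
  move=> /sP[A [B [D [At _ Bs PX]]]].
  have A10 : A i1 i0 = 0.
    apply/eqP; apply: contraT => /At; rewrite eq_sym => /(_ i01).
    by rewrite ltC 1?eq_sym // lt01.
  have Bij i j : B i j = - B j i.
    by apply/eqP; rewrite -addr_eq0; move/matrixP/(_ i j)/eqP: Bs; rewrite !mxE.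
  have Bii i : B i i = 0 by apply/eqP; rewrite -eqNr -Bij.
  exists (A i0 i0), (A i1 i1), (A i0 i1), (B i0 i1), (row i0 D), (row i1 D).
  rewrite PX /so_mx {1}(mx2E i01 A) {1}(mx2E i01 B) {1}(rows2E i01 D) A10 !Bii.
  by rewrite (Bij i1).
move=> [a [d [b [z [x [y PX]]]]]]; apply/sP.
exists (mx2 i0 a b 0 d), (mx2 i0 0 z (- z) 0), (rows2 i0 x y); split=> //.
- move=> i j ij; rewrite mxE; case: (index2 i01 i) ij => ->; case: (index2 i01 j) => ->;
    rewrite ?eqxx // eq_sym (negPf i01) ?eqxx //.
- by move=> i; apply: num_real.
- by rewrite (mx2_adj i01) (mx2D i01) [RHS](mx2_0 _ i01) addr0 subrr addNr.
Qed.

(** With the notation of [so_mx], s1 is given by a = - d and z = x = y = 0, and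
    s2 by a = d and b = 0. *)
Lemma so_components k (s : {vspace 'M[R]_(2 + (2 + k))}) :
  is_iwasawa_component (so R 2 (2 + k)) s ->
  exists s1 s2 : {vspace 'M[R]_(2 + (2 + k))},
    [/\ is_split_extension s s1 s2, is_heis 0 s1 & is_heis k s2].
Proof.
case/so_coordinates => P [i0 [i1 [i01 PJ sP]]].
pose phi (x : 'M[R]_(2 + (2 + k))) := x.
have lieE X Y a d b z x y a' d' b' z' x' y' :
    P *m X = so_mx i0 a d b z x y *m P -> P *m Y = so_mx i0 a' d' b' z' x' y' *m P ->
    P *m lie X Y = so_mx i0 0 0 ((a - d) * b' - (a' - d') * b)
      ((a + d) * z' - (a' + d') * z + symplectic x y x' y')
      (a *: x' + b *: y' - (a' *: x + b' *: y)) (d *: y' - d' *: y) *m P.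
  move=> PX PY; rewrite -(so_mx_lie i01).
  exact: (lie_coordinates (phi := phi) (fun x y => erefl) PX PY).
have addE X Y a d b z x y a' d' b' z' x' y' :
    P *m X = so_mx i0 a d b z x y *m P -> P *m Y = so_mx i0 a' d' b' z' x' y' *m P ->
    P *m (X + Y) = so_mx i0 (a + a') (d + d') (b + b') (z + z') (x + x') (y + y') *m P.
  move=> PX PY; have := so_mx_linear i01 1 a d b z x y a' d' b' z' x' y'.
  by rewrite !mul1r !scale1r => ->; rewrite mulmxDr mulmxDl PX PY.
have so_mx_eq X a d b z x y a' d' b' z' x' y' : P *m X = so_mx i0 a d b z x y *m P ->
    a = a' -> d = d' -> b = b' -> z = z' -> x = x' -> y = y' ->
    P *m X = so_mx i0 a' d' b' z' x' y' *m P.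
  by move=> + <- <- <- <- <- <-.
have [||||||| s1 s1P H1] := heis_parabolic real_norm idfun_real (phi := phi) (psi := phi)
  _ _ _ _ PJ
  (A := fun u : heis R 0 => mx2 i0 u.1.1.1 u.1.1.2 0 (- u.1.1.1))
  (B := fun=> mx2 i0 0 0 (- 0) 0) (C := fun=> rows2 i0 (0 : 'rV_k) 0).
- by [].
- by [].
- by [].
- by [].
- move=> c u v; rewrite !(mx2Z i01, mx2D i01, rows2Z i01, rows2D i01) /=.
  by rewrite !mulr0 !scaler0 !addr0 oppr0 !mulr0 addr0 mulrN opprD.
- move=> [[[a b] x] y] [[[a' b'] x'] y'] /=.
  move=> /(mx2_inj i01)[-> -> _ _] _ _.
  by rewrite [x]thinmx0 [x']thinmx0 [y]thinmx0 [y']thinmx0.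
- move=> [[[a b] x] y] [[[a' b'] x'] y'] /=.
  rewrite (so_mx_lie i01 a (- a) b 0 0 0 a' (- a') b' 0 0 0) /so_mx.
  have -> : symplectic x y x' y' = 0 by rewrite /symplectic !mxE !big_ord0 subr0.
  have -> : symplectic (0 : 'rV[R]_k) 0 0 0 = 0 by rewrite /symplectic !mul0mx subrr.
  apply: f_equal3.
  + by congr (mx2 _ _ _ _ _); ring.
  + by congr (mx2 _ _ _ _ _); ring.
  + by rewrite !scaler0 !addr0 subr0.
have [||||||| s2 s2P H2] := heis_parabolic real_norm idfun_real (phi := phi) (psi := phi)
  _ _ _ _ PJ
  (A := fun u : heis R k => mx2 i0 u.1.1.1 0 0 u.1.1.1)
  (B := fun u => mx2 i0 0 u.1.1.2 (- u.1.1.2) 0) (C := fun u => rows2 i0 u.1.2 u.2).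
- by [].
- by [].
- by [].
- by [].
- move=> c u v; rewrite !(mx2Z i01, mx2D i01, rows2Z i01, rows2D i01) /=.
  by rewrite !mulr0 !addr0 mulrN opprD.
- move=> [[[a b] x] y] [[[a' b'] x'] y'] /=.
  by move=> /(mx2_inj i01)[-> _ _ _] /(mx2_inj i01)[_ -> _ _] /(rows2_inj i01)[-> ->].
- move=> [[[a b] x] y] [[[a' b'] x'] y'] /=.
  rewrite (so_mx_lie i01 a a 0 b x y a' a' 0 b' x' y') /so_mx.
  apply: f_equal3.
  + by congr (mx2 _ _ _ _ _); ring.
  + by congr (mx2 _ _ _ _ _); ring.
  + by rewrite !scale0r !addr0.
have {}s1P X : X \in s1 <-> exists t c, P *m X = so_mx i0 t (- t) c 0 0 0 *m P.
  split=> [/s1P[u Pu]|[t [c PX]]]; first by exists u.1.1.1, u.1.1.2.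
  by apply/s1P; exists (t, c, 0, 0).
have {}s2P X : X \in s2 <-> exists t z x y, P *m X = so_mx i0 t t 0 z x y *m P.
  split=> [/s2P[u Pu]|[t [z [x [y PX]]]]]; first by exists u.1.1.1, u.1.1.2, u.1.2, u.2.
  by apply/s2P; exists (t, z, x, y).
exists s1, s2; split=> //; split.
- move=> X Y /s1P[t [c PX]] /s1P[t' [c' PY]]; apply/s1P.
  exists 0, (2 * (t * c' - t' * c)).
  apply: (so_mx_eq _ _ _ _ _ _ _ _ _ _ _ _ _ (lieE _ _ _ _ _ _ _ _ _ _ _ _ _ _ PX PY)) => //.
  - by rewrite oppr0.
  - ring.
  - by rewrite !mulr0 subrr add0r /symplectic !mul0mx subrr.
  - by rewrite !scaler0 addr0 subr0.
  - by rewrite !scaler0 subr0.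
- split.
    apply/subvP => X /s2P[t [z [x [y PX]]]]; apply/sP.
    by exists t, t, 0, z, x, y.
  move=> X Y /sP[a [d [b [z [x [y PX]]]]]] /s2P[t [z' [x' [y' PY]]]]; apply/s2P.
  exists 0; do 3 eexists.
  apply: (so_mx_eq _ _ _ _ _ _ _ _ _ _ _ _ _ (lieE _ _ _ _ _ _ _ _ _ _ _ _ _ _ PX PY)) => //.
  by rewrite mulr0 subrr mul0r subr0.
- apply/vspaceP => X; apply/idP/idP.
    move=> /sP[a [d [b [z [x [y PX]]]]]].
    pose X1 := from_coordinates phi P (so_mx i0 ((a - d) / 2) (- ((a - d) / 2)) b 0 0 0).
    pose X2 := from_coordinates phi P (so_mx i0 ((a + d) / 2) ((a + d) / 2) 0 z x y).
    have P1 := from_coordinatesK (phi := phi) (psi := phi) (fun=> erefl) PJ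
      (so_mx i0 ((a - d) / 2) (- ((a - d) / 2)) b 0 0 0).
    have P2 := from_coordinatesK (phi := phi) (psi := phi) (fun=> erefl) PJ
      (so_mx i0 ((a + d) / 2) ((a + d) / 2) 0 z x y).
    have -> : X = X1 + X2.
      apply: (coordinates_inj (phi := phi) (psi := phi) (fun=> erefl) PJ PX).
      (* the diagonal (a, d) is ((a - d)/2, (d - a)/2) plus a scalar *)
      by apply: (so_mx_eq _ _ _ _ _ _ _ _ _ _ _ _ _ (addE _ _ _ _ _ _ _ _ _ _ _ _ _ _ P1 P2));
        rewrite ?add0r ?addr0 //; field.
    have m1 : X1 \in s1 by apply/s1P; exists ((a - d) / 2), b; exact: P1.
    have m2 : X2 \in s2 by apply/s2P; exists ((a + d) / 2), z, x, y; exact: P2.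
    exact: (memv_add m1 m2).
  move=> /memv_addP[X1 /s1P[t [c P1]] [X2 /s2P[t' [z [x [y P2]]]] ->]].
  by apply/sP; do 6 eexists; exact: addE P1 P2.
- apply/directv_addP/eqP; rewrite -subv0; apply/subvP => X /memv_capP[].
  move=> /s1P[t [c P1]] /s2P[t' [z [x [y P2]]]]; rewrite memv0; apply/eqP.
  move: (P1); rewrite P2 => /(congr1 (mulmx^~ (invmx P))).
  rewrite !mulmxK ?(witt_unit PJ) // => /(so_mx_inj i01)[tt' t'N c0 [z0 x0 y0]].
  have t0 : t' = 0 by apply/eqP; rewrite -eqNr {1}tt' t'N.
  apply: (coordinates_inj (phi := phi) (psi := phi) (fun=> erefl) PJ (Y := 0)).
    rewrite [LHS]P2 t0 z0 x0 y0 /so_mx -(mx2_0 _ i01) oppr0 -(mx2_0 _ i01) -(rows2_0 _ i01).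
    by rewrite parabolic_mx0.
  by rewrite /phi mulmx0 mul0mx.
Qed.

End OrthogonalComponent.

(** * The split extension *)

Theorem mainTheorem5 (R : realType) (l : nat) (hl : (3 <= l)%N)
    (s : {vspace 'M[R]_(2 + (l - 1))})
    (t1 : {vspace cmx R (1 + 1)})
    (t2 : {vspace cmx R (1 + (l - 2))})
    (hs : is_iwasawa_component (so R 2 (l - 1)) s)
    (ht1 : is_iwasawa_component (su R 1 1) t1)
    (ht2 : is_iwasawa_component (su R 1 (l - 2)) t2) :
  exists s1 s2 : {vspace 'M[R]_(2 + (l - 1))},
    [/\ is_split_extension s s1 s2,
        lie_isomorphic s1 t1
      & lie_isomorphic s2 t2].
Proof.
have [k lk] : exists k, l = k.+3 by exists (l - 3)%N; rewrite -addn3 subnK.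
have e1 : (l - 1 = 2 + k)%N by rewrite lk subSS subn0.
have e2 : (l - 2 = 1 + k)%N by rewrite lk !subSS subn0.
move: s t2 hs ht2; rewrite e1 e2 => s t2 hs ht2.
have [s1 [s2 [ss H1 H2]]] := so_components hs.
exists s1, s2; split=> //; first exact: heis_isomorphic H1 (@su_heis R 0 t1 ht1).
exact: heis_isomorphic H2 (su_heis ht2).
Qed.
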